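(* Let $M$ be a compact strictly pseudoconvex CR manifold of CR dimension $n$. Let $\theta$ be a contact form on $M$ such that the Levi form $G_\theta$ is positive definite. Let $\lambda$ be a nonzero eigenvalue of the sublaplacian $\Delta_b$. Suppose that there is a constant $k>0$ such that (i) $\rho(X,X)+2A(X,JX)\ge k\,G_\theta(X,X)$ for all $X\in H(M)$, and (ii) there is an eigenfunction $f\in\mathrm{Eigen}(\Delta_b;\lambda)$ (so $f\neq 0$) such that $T(f)=0$. Then $\lambda$ satisfies the estimate $$-\lambda\ \ge\ \frac{2nk}{2n-1}.$$
   Context: A CR manifold $(M,T_{1,0}(M))$ of CR dimension $n$ is an oriented smooth $(2n+1)$-dimensional manifold with a complex rank $n$ involutive subbundle $T_{1,0}(M)\subset T(M)\otimes\mathbb{C}$ with $T_{1,0}(M)\cap T_{0,1}(M)=(0)$, $T_{0,1}(M)=\overline{T_{1,0}(M)}$. $H(M)=\mathrm{Re}\{T_{1,0}(M)\oplus T_{0,1}(M)\}$, with complex structure $J(Z+\overline Z)=i(Z-\overline Z)$, $Z\in T_{1,0}(M)$. A pseudohermitian structure is a real $1$-form $\theta$ with $\mathrm{Ker}(\theta)=H(M)$; the Levi form is $G_\theta(X,Y)=(d\theta)(X,JY)$, $X,Y\in H(M)$ (exterior derivative normalized by $2\,d\theta(X,Y)=X(\theta(Y))-Y(\theta(X))-\theta([X,Y])$). $M$ is strictly pseudoconvex if $G_\theta$ is definite; $\theta$ is chosen so that $G_\theta$ is positive definite, and $\theta$ is then a contact form. $T$ (the characteristic direction of $d\theta$) is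 the vector field with $\theta(T)=1$, $T\rfloor d\theta=0$; $J$ is extended by $JT=0$. The Webster metric is the Riemannian metric $g_\theta$ with $g_\theta=G_\theta$ on $H(M)$, $g_\theta(X,T)=0$ for $X\in H(M)$, $g_\theta(T,T)=1$. $\pi_H:T(M)\to H(M)$ is the projection relative to $T(M)=H(M)\oplus\mathbb{R}T$. The Tanaka-Webster connection $\nabla$ is the unique linear connection on $M$ such that $H(M)$ is $\nabla$-parallel, $\nabla g_\theta=0$, $\nabla J=0$, and its torsion $T_\nabla$ satisfies $T_\nabla(Z,W)=0$, $T_\nabla(Z,\overline W)=2iG_\theta(Z,\overline W)T$ for $Z,W\in T_{1,0}(M)$ ($G_\theta$ extended $\mathbb{C}$-bilinearly), and $\tau\circ J+J\circ\tau=0$, where $\tau(X)=T_\nabla(T,X)$. The sublaplacian is $\Delta_b f=\mathrm{div}(\nabla^H f)$, where $\nabla^H f=\pi_H\nabla f$, $g_\theta(\nabla f,X)=X(f)$, and the divergence is with respect to $g_\theta$. $\mathrm{Eigen}(\Delta_b;\lambda)=\{f\in C^\infty(M):\Delta_bf=\lambda f\}$ (real-valued functions); with this sign convention the nonzero eigenvalues are negative. $\rho(X,Y)=\mathrm{trace}\{Z\mapsto R(Z,Y)X\}$ with $R$ the curvature tensor of $\nabla$, $R(X,Y)=\nabla_X\nabla_Y-\nabla_Y\nabla_X-\nabla_{[X,Y]}$, and $A(X,Y)=g_\theta(\tau X,Y)$ is the pseudohermitian torsion. *)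

(* Defs.v *)
From HB Require Import structures.
From mathcomp Require Import all_boot all_order all_algebra.
From mathcomp Require Import all_classical all_reals all_analysis.
From mathcomp Require Import complex.
Set Implicit Arguments.
Unset Strict Implicit.
Unset Printing Implicit Defensive.
Import Order.TTheory GRing.Theory Num.Theory numFieldNormedType.Exports.
Local Open Scope classical_set_scope.
Local Open Scope ring_scope.
Local Open Scope complex_scope.

Section SmoothEuclidean.
Variables (R : realType) (d : nat).
Implicit Types (U : set 'rV[R]_d) (f g : 'rV[R]_d -> R).

(* Only meant for open U: derivatives are taken in the ambient space. *)
Fixpoint Ck (k : nat) U f : Prop :=
  (forall x, U x -> {for x, continuous f}) /\
  if k is k'.+1 then
    forall i : 'I_d, (forall x, U x -> derivable f x (delta_mx 0 i)) /\
                     Ck k' U (fun x => 'D_(delta_mx 0 i) f x)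
  else True.

Definition smooth_on U f := forall k, Ck k U f.

Lemma Ck_ext k U f g : open U -> (forall x, U x -> f x = g x) ->
  Ck k U f -> Ck k U g.
Proof.
move=> oU; have nearE (f1 g1 : _ -> R) x : (forall y, U y -> f1 y = g1 y) -> U x ->
    \near x, f1 x = g1 x.
  by move=> fg Ux; apply: filterS fg _; exact: open_nbhs_nbhs.
have contE f1 g1 : (forall x, U x -> f1 x = g1 x) ->
    (forall x, U x -> {for x, continuous f1}) ->
    forall x, U x -> {for x, continuous g1}.
  move=> fg cf x Ux; rewrite /prop_for /continuous_at -(fg _ Ux).
  have := cf x Ux; apply: cvg_trans; apply: (@near_eq_cvg _ _ (nbhs x)).
  by apply: (nearE f1 g1) => // y Uy; rewrite fg.
elim: k f g => [|k IH] f g fg /= [cf df]; split=> //; try exact: contE cf.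
move=> i; have [dfi Cfi] := df i; split.
  by move=> x Ux; apply: near_eq_derivable (dfi x Ux); exact: nearE.
apply: IH Cfi => x Ux; apply: near_eq_derive; exact: nearE.
Qed.

Lemma CkS k U f : Ck k.+1 U f -> Ck k U f.
Proof.
elim: k f => [|k IH] f /= [cf df]; split=> // i.
by have [dfi Cfi] := df i; split=> //; exact: IH.
Qed.

Lemma Ck_cst k U (a : R) : open U -> Ck k U (cst a).
Proof.
move=> oU; elim: k a => [|k IH] a /=; split=> //; try by move=> x _; exact: cst_continuous.
move=> i; split=> [x _|]; first exact: derivable_cst.
by apply: Ck_ext (IH 0) => // x _; rewrite derive_cst.
Qed.

Lemma CkB k U f g : open U -> Ck k U f -> Ck k U g -> Ck k U (f - g).
Proof.
move=> oU; elim: k f g => [|k IH] f g /= [cf df] [cg dg]; split=> //.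
- by move=> x Ux; apply: continuousB; [exact: cf|exact: cg].
- by move=> x Ux; apply: continuousB; [exact: cf|exact: cg].
move=> i; have [dfi Cfi] := df i; have [dgi Cgi] := dg i; split.
  by move=> x Ux; apply: derivableB; [exact: dfi|exact: dgi].
apply: Ck_ext (IH _ _ Cfi Cgi) => // x Ux.
by rewrite [RHS]deriveB //; [exact: dfi|exact: dgi].
Qed.

Lemma CkM k U f g : open U -> Ck k U f -> Ck k U g -> Ck k U (f * g).
Proof.
have CkD l V f1 f2 : open V -> Ck l V f1 -> Ck l V f2 -> Ck l V (f1 + f2).
  move=> oV C1 C2; rewrite -[f2]opprK; apply: CkB => //.
  by rewrite -[- f2]sub0r; apply: CkB => //; exact: Ck_cst.
move=> oU; elim: k f g => [|k IH] f g.
  move=> /= [cf df] [cg dg]; split=> //.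
  by move=> x Ux; apply: continuousM; [exact: cf|exact: cg].
move=> Cf Cg; have [cf df] := Cf; have [cg dg] := Cg; split=> //.
  by move=> x Ux; apply: continuousM; [exact: cf|exact: cg].
move=> i; have [dfi Cfi] := df i; have [dgi Cgi] := dg i; split.
  by move=> x Ux; apply: derivableM; [exact: dfi|exact: dgi].
apply: (@Ck_ext _ _ (f * (fun x => 'D_(delta_mx 0 i) g x) +
                    g * (fun x => 'D_(delta_mx 0 i) f x))) => //.
  by move=> x Ux; rewrite [RHS]deriveM //; [exact: dfi|exact: dgi].
by apply: CkD => //; apply: IH => //; exact: CkS.
Qed.

End SmoothEuclidean.

Section Manifold.
Variables (R : realType) (d : nat).

(* [cinv] is only meaningful on the image of [cdom]. *)
Record chart (X : topologicalType) := Chart {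
  cdom : set X;
  cfwd : X -> 'rV[R]_d;
  cinv : 'rV[R]_d -> X;
  cdom_open : open cdom;
  cimg_open : open (cfwd @` cdom);
  cfwdK : forall p, cdom p -> cinv (cfwd p) = p;
  cfwd_continuous : {within cdom, continuous cfwd};
  cinv_continuous : {within cfwd @` cdom, continuous cinv} }.

Definition oriented_compatible X (c c' : chart X) :=
  let V := cfwd c @` (cdom c `&` cdom c') in
  let tr := fun x => cfwd c' (cinv c x) in
  (forall j, smooth_on V (fun x => tr x 0 j)) /\
  (forall x, V x -> 0 < \det ('J tr x)).

Record omanifold := OManifold {
  mcarrier :> topologicalType;
  atlas : set (chart mcarrier);
  m_hausdorff : hausdorff_space mcarrier;
  m_second_countable : @second_countable mcarrier;
  atlas_cover : forall p, exists2 c, atlas c & cdom c p;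
  atlas_compatible : forall c c', atlas c -> atlas c' ->
    oriented_compatible c c' }.

Variable M : omanifold.

Definition smooth : {pred M -> R} := fun f =>
  `[< forall c, atlas c -> smooth_on (cfwd c @` cdom c) (f \o cinv c) >].

Lemma smooth_subring : subring_closed smooth.
Proof.
split=> [|f g /asboolP Cf /asboolP Cg|f g /asboolP Cf /asboolP Cg];
  apply/asboolP => c ac k.
- exact/Ck_cst/cimg_open.
- by apply: CkB; [exact: cimg_open|exact: Cf|exact: Cg].
- by apply: CkM; [exact: cimg_open|exact: Cf|exact: Cg].
Qed.

HB.instance Definition _ :=
  GRing.isSubringClosed.Build (M -> R) smooth smooth_subring.

(* The ring C^oo(M); it is the zero ring when M is empty. *)
Record Cinf := MkCinf { cinf_fun :> M -> R; _ : cinf_fun \in smooth }.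

HB.instance Definition _ := [isSub for cinf_fun].
HB.instance Definition _ := [Choice of Cinf by <:].
HB.instance Definition _ := GRing.SubChoice_isSubComPzRing.Build (M -> R) smooth Cinf (subringClosedP _).

Lemma smooth_cst (a : R) : (cst a : M -> R) \in smooth.
Proof. by apply/asboolP => c ac k; exact/Ck_cst/cimg_open. Qed.

Definition scst (a : R) : Cinf := MkCinf (smooth_cst a).

(* Smooth vector fields are the R-linear derivations of C^oo(M). *)
Definition derivation : {pred Cinf -> Cinf^o} := fun D =>
  `[< [/\ forall f g, D (f + g) = D f + D g,
          forall a f, D (scst a * f) = scst a * D f
        & forall f g, D (f * g) = f * D g + g * D f] >].

Lemma derivation_submod : submod_closed derivation.
Proof.
split.
  apply/asboolP; split=> [f g|a f|f g];
    by rewrite ![(0 : Cinf -> Cinf^o) _]/(0 : Cinf) ?addr0 ?mulr0 ?addr0.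
move=> a D E /asboolP[DD DZ DM] /asboolP[ED EZ EM].
have E' f : (a *: D + E : Cinf -> Cinf^o) f = a * D f + E f by [].
apply/asboolP; split=> [f g|b f|f g]; rewrite !E'.
- by rewrite DD ED mulrDr addrACA.
- by rewrite DZ EZ mulrDr mulrCA.
- by rewrite DM EM !mulrDr addrACA mulrCA [a * (g * _)]mulrCA.
Qed.

HB.instance Definition _ :=
  GRing.isSubmodClosed.Build Cinf (Cinf -> Cinf^o) derivation derivation_submod.

Record VF := MkVF { vf_fun :> Cinf -> Cinf^o; _ : vf_fun \in derivation }.

HB.instance Definition _ := [isSub for vf_fun].
HB.instance Definition _ := [Choice of VF by <:].
HB.instance Definition _ := [SubChoice_isSubLmodule of VF by <:].

Lemma bracket_derivation (X Y : VF) :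
  (fun f => X (Y f) - Y (X f) : Cinf^o) \in derivation.
Proof.
case: X Y => [X /asboolP[XD XZ XM]] [Y /asboolP[YD YZ YM]] /=.
apply/asboolP; split=> [f g|a f|f g].
- by rewrite YD XD XD YD opprD addrACA.
- by rewrite YZ XZ XZ YZ -mulrBr.
- rewrite YM XD !XM YD !YM !mulrBr (mulrC (X g) (Y f)) (mulrC (X f) (Y g)).
  rewrite (addrACA (f * X (Y g))) (addrACA (f * Y (X g))) (addrC (Y f * X g)).
  by rewrite opprD [LHS]addrACA [X in _ + X]subrr addr0 opprD addrACA.
Qed.

Definition bracket (X Y : VF) : VF := MkVF (bracket_derivation X Y).

Definition oneform := {linear VF -> Cinf^o}.

Definition vf_at (p : M) (X : VF) : Cinf -> R := fun f => X f p.

(* L is meant to be C^oo(M)-linear; its trace at p is computed in any frame of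
   the tangent space at p, with the dual coframe. Every tangent vector and
   covector at p extends to a global field, so such frames always exist. *)
Definition is_trace (L : VF -> VF) (h : Cinf) :=
  forall (p : M) (e : 'I_d -> VF) (a : 'I_d -> oneform),
    (forall i j, (a i (e j) : Cinf) p = (i == j)%:R) ->
    h p = \sum_i (a i (L (e i)) : Cinf) p.

Definition is_riemannian (g : VF -> VF -> Cinf) :=
  [/\ forall f X Y Z, g (f *: X + Y) Z = f * g X Z + g Y Z,
      forall X Y, g X Y = g Y X
    & forall X p, vf_at p X <> 0 -> 0 < g X X p].

Definition is_connection (nabla : VF -> VF -> VF) :=
  [/\ forall f X Y Z, nabla (f *: X + Y) Z = f *: nabla X Z + nabla Y Z,
      forall X Y Z, nabla X (Y + Z) = nabla X Y + nabla X Z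
    & forall (X : VF) f Y, nabla X (f *: Y) = (X f : Cinf) *: Y + f *: nabla X Y].

Definition torsion (nabla : VF -> VF -> VF) X Y :=
  nabla X Y - nabla Y X - bracket X Y.

Definition curvature (nabla : VF -> VF -> VF) X Y Z :=
  nabla X (nabla Y Z) - nabla Y (nabla X Z) - nabla (bracket X Y) Z.

Definition is_metric_connection (g : VF -> VF -> Cinf)
    (nabla : VF -> VF -> VF) :=
  forall X Y Z : VF, X (g Y Z) = g (nabla X Y) Z + g Y (nabla X Z).

Definition is_levi_civita g nabla :=
  [/\ is_connection nabla, forall X Y, torsion nabla X Y = 0
    & is_metric_connection g nabla].

Definition is_gradient (g : VF -> VF -> Cinf) (grad : Cinf -> VF) :=
  forall f (X : VF), g (grad f) X = X f.

Definition is_divergence (g : VF -> VF -> Cinf) (div : VF -> Cinf) :=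
  exists2 D, is_levi_civita g D & forall X, is_trace (D^~ X) (div X).

Definition is_ricci (nabla : VF -> VF -> VF) (rho : VF -> VF -> Cinf) :=
  forall X Y, is_trace (fun Z => curvature nabla Z Y X) (rho X Y).

(* A pair (x, y) stands for x + iy. *)
Definition cof (V : zmodType) (x : V) : V * V := (x, 0).
Definition cconj (V : zmodType) (z : V * V) : V * V := (z.1, - z.2).
Definition cmuli (V : zmodType) (z : V * V) : V * V := (- z.2, z.1).
Definition cbilin (U V : zmodType) (B : U -> U -> V) (z w : U * U) : V * V :=
  (B z.1 w.1 - B z.2 w.2, B z.1 w.2 + B z.2 w.1).

Definition CVF : Type := (VF * VF)%type.

(* A vector of T_p(M) (x) C is a complex-valued derivation at p. *)
Definition cvf_at (p : M) (Z : CVF) : Cinf -> R[i] :=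
  fun f => (Z.1 f : Cinf) p +i* (Z.2 f : Cinf) p.

Definition ctan_conj (w : Cinf -> R[i]) : Cinf -> R[i] := fun f => (w f)^*.

Definition is_section (E : M -> set (Cinf -> R[i])) (Z : CVF) :=
  forall p, E p (cvf_at p Z).

(* Local frames are given by global vector fields, which is no restriction:
   any local section agrees near p with a global vector field. *)
Definition is_complex_subbundle (r : nat) (E : M -> set (Cinf -> R[i])) :=
  forall p : M, exists Z : 'I_r -> CVF, \forall q \near nbhs p,
    (forall c : 'I_r -> R[i],
       (forall f, \sum_i c i * cvf_at q (Z i) f = 0) -> forall i, c i = 0) /\
    E q = [set w | exists c : 'I_r -> R[i],
                     forall f, w f = \sum_i c i * cvf_at q (Z i) f].

Record CR_structure (n : nat) := CRStructure {
  T10 :> M -> set (Cinf -> R[i]);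
  T10_subbundle : is_complex_subbundle n T10;
  T10_involutive : forall Z W, is_section T10 Z -> is_section T10 W ->
    is_section T10 (cbilin bracket Z W);
  T10_T01 : forall p w, T10 p w -> T10 p (ctan_conj w) -> w = 0 }.

Section CR.
Variables (n : nat) (E : CR_structure n).

(* H(M) = Re (T_{1,0} (+) T_{0,1}), fibrewise. *)
Definition Hbundle (p : M) : set (Cinf -> R) :=
  [set v | exists Z W, [/\ E p Z, E p W &
             forall f, v f = complex.Re (Z f + ctan_conj W f)]].

Definition horizontal (X : VF) := forall p, Hbundle p (vf_at p X).

Definition is_pseudohermitian (theta : oneform) :=
  forall X p, (theta X : Cinf) p = 0 <-> Hbundle p (vf_at p X).

(* Normalized by 2 d(theta)(X,Y) = X theta(Y) - Y theta(X) - theta([X,Y]). *)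
Definition ext_d (theta : oneform) (X Y : VF) : Cinf :=
  scst 2^-1 * (X (theta Y) - Y (theta X) - theta (bracket X Y)).

Definition is_characteristic (theta : oneform) (T : VF) :=
  theta T = 1 :> Cinf /\ forall X, ext_d theta T X = 0.

(* J (Z + conj Z) = i (Z - conj Z) on T_{1,0}; Z + conj Z is the real field
   given by its first component. *)
Definition is_complex_structure (T : VF) (J : {linear VF -> VF}) :=
  J T = 0 /\
  forall Z, is_section E Z ->
    cof (J (Z + cconj Z : VF * VF).1) = cmuli (Z - cconj Z).

Definition levi (theta : oneform) (J : VF -> VF) (X Y : VF) : Cinf :=
  ext_d theta X (J Y).

Definition levi_positive theta J := forall X, horizontal X ->
  forall p, vf_at p X <> 0 -> 0 < levi theta J X X p.

Definition is_webster_metric theta J T (g : VF -> VF -> Cinf) :=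
  [/\ is_riemannian g,
      forall X Y, horizontal X -> horizontal Y -> g X Y = levi theta J X Y,
      forall X, horizontal X -> g X T = 0
    & g T T = 1].

Definition tau (nabla : VF -> VF -> VF) (T X : VF) : VF := torsion nabla T X.

Definition ps_torsion (g : VF -> VF -> Cinf) nabla T (X Y : VF) : Cinf :=
  g (tau nabla T X) Y.

Definition is_tanaka_webster theta (J : VF -> VF) T g nabla :=
  is_connection nabla /\
  (forall X Y, horizontal Y -> horizontal (nabla X Y)) /\
  is_metric_connection g nabla /\
  (forall X Y, nabla X (J Y) = J (nabla X Y)) /\
  (forall Z W, is_section E Z -> is_section E W ->
     cbilin (torsion nabla) Z W = 0 /\
     cbilin (torsion nabla) Z (cconj W) =
       (let c := cmuli (cbilin (levi theta J) Z (cconj W)) *+ 2 in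
        (c.1 *: T, c.2 *: T))) /\
  (forall X, tau nabla T (J X) + J (tau nabla T X) = 0).

Definition pi_H (theta : oneform) (T X : VF) : VF :=
  X - (theta X : Cinf) *: T.

Definition sublaplacian theta T (grad : Cinf -> VF) (div : VF -> Cinf) f :=
  div (pi_H theta T (grad f)).

End CR.

Definition Eigen (Delta : Cinf -> Cinf) (lam : R) : set Cinf :=
  [set f | Delta f = scst lam * f].

Definition operator_eigenvalue (Delta : Cinf -> Cinf) (lam : R) :=
  exists2 f, f != 0 & Eigen Delta lam f.

End Manifold.

(* Main.v *)
(* The estimate follows from the maximum principle, without integration. Let u be
   the horizontal gradient of f. Since T f = 0, the horizontal Hessian of f is
   symmetric and the Bochner formula reads
     1/2 Delta_b |u|^2 = |Hess f|^2 + lambda |u|^2 + rho(u,u) - 2 A(u,Ju).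
   The first Bianchi identity gives
     rho(X,X) - rho(JX,JX) = 4 (n-1) A(X,JX),
   so a convex combination of hypothesis (i) at u and at Ju bounds
   rho(u,u) - 2 A(u,Ju) below by k |u|^2. If the estimate failed, then for a
   suitable alpha > 0 the function P = |u|^2 + alpha f^2 would satisfy
     1/2 Delta_b P >= c |u|^2 + c' f^2   with c, c' > 0,
   and at a maximum of P this forces P = 0, hence f = 0. *)

Require Import Defs.
From HB Require Import structures.
From mathcomp Require Import all_boot all_order all_algebra.
From mathcomp Require Import all_classical all_reals all_analysis.
From mathcomp Require Import ring lra complex.
Set Implicit Arguments.
Unset Strict Implicit.
Unset Printing Implicit Defensive.
Import Order.TTheory GRing.Theory Num.Theory numFieldNormedType.Exports.
Local Open Scope classical_set_scope.
Local Open Scope ring_scope.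

(** * Smooth functions on R^d *)

(** The constant is the compatibility condition for alpha. Since Hess f has trace lambda f on a
    space of dimension 2n, |Hess f|^2 >= (lambda f)^2 / (2n); positivity of c and c' then asks for
    alpha > - lambda - k and, when lambda < 0, alpha < - lambda / (2n). Such an alpha > 0 exists
    exactly when - lambda < 2nk / (2n-1). The obstacle is that vector fields are derivations of the
    ring of global functions, while the maximum principle is about second derivatives in a chart.
    Cut-off functions make derivations local. That a derivation at a point is a combination of
    coordinate derivatives follows from a dimension count: T and the real and imaginary parts of a
    local frame of T_{1,0} are 2n+1 fields spanning the tangent space, as many as there are
    coordinates. Traces are taken in horizontal frames orthonormal on a neighbourhood of the point,
    because the Bochner computation differentiates the orthonormality relations and div u; the frame
    need not be parallel at the point. *)

Section Line.
Variables (R : realType) (V : normedModType R).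
Implicit Types (f : V -> R) (x v : V).

Lemma is_derive_line f x v (t : R) : derivable f (x + t *: v) v ->
  is_derive t 1 (fun s : R => f (x + s *: v)) ('D_v f (x + t *: v)).
Proof.
have E : (fun h : R => h^-1 *: (((fun s : R => f (x + s *: v)) \o shift t) (h *: 1) -
      f (x + t *: v))) =
    (fun h => h^-1 *: ((f \o shift (x + t *: v)) (h *: v) - f (x + t *: v))).
  apply/funext => h /=; congr (_ *: (f _ - _)).
  by rewrite [h *: 1]mulr1 scalerDl addrCA.
by move=> df; apply: DeriveDef; [rewrite /derivable E|rewrite /derive E].
Qed.

(** The increment c will be a coordinate of an arbitrary vector, so it may have either sign; the
    bound on [|t|] covers both orientations of the segment. *)
Lemma MVT_line f x v (c : R) :
  (forall t, `|t| <= `|c| -> derivable f (x + t *: v) v) ->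
  exists2 t, `|t| <= `|c| & f (x + c *: v) - f x = c * 'D_v f (x + t *: v).
Proof.
move=> df; pose g (s : R) := f (x + s *: v).
have cont a b : (forall t, t \in `[a, b] -> `|t| <= `|c|) ->
    {within `[a, b], continuous g}.
  move=> ab; apply: continuous_in_subspaceT => t /set_mem tab.
  apply: differentiable_continuous; apply/derivable1_diffP.
  by have [] := is_derive_line (df t (ab t tab)).
have [c0|c0] := leP 0 c.
- have sub t : t \in `[0, c] -> `|t| <= `|c|.
    by rewrite in_itv/= => /andP[t0 tc]; rewrite !ger0_norm.
  have [||t tI] := @MVT_segment R g (fun t => 'D_v f (x + t *: v)) 0 c c0.
  + move=> t tI; apply: is_derive_line; apply: df; apply: sub.
    exact: subset_itv_oo_cc.
  + exact: cont.
  rewrite /g scale0r addr0 subr0 mulrC => e; exists t => //.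
  exact: sub.
- have sub t : t \in `[c, 0] -> `|t| <= `|c|.
    rewrite in_itv/= => /andP[t0 tc].
    by rewrite !ler0_norm ?lerN2// ltW.
  have [||t tI] := @MVT_segment R g (fun t => 'D_v f (x + t *: v)) c 0 (ltW c0).
  + move=> t tI; apply: is_derive_line; apply: df; apply: sub.
    exact: subset_itv_oo_cc.
  + exact: cont.
  rewrite /g scale0r addr0 sub0r => e; exists t; first exact: sub.
  by rewrite -opprB e mulrN opprK mulrC.
Qed.

End Line.

(** * Continuous partial derivatives imply differentiability *)

Section C1.
Variables (R : realType) (d : nat).
Implicit Types (f : 'rV[R]_d -> R) (x v : 'rV[R]_d).
Local Notation ei j := (delta_mx 0 j : 'rV[R]_d).

Lemma rV_le_norm v (j : 'I_d) : `|v 0 j| <= `|v|.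
Proof.
rewrite [leRHS]/Num.Def.normr/= mx_normrE.
exact: (le_bigmax _ (fun i : 'I_1 * 'I_d => `|v i.1 i.2|) (0, j)).
Qed.

Lemma rV_norm_le v (M : R) : 0 <= M -> (forall j, `|v 0 j| <= M) -> `|v| <= M.
Proof.
move=> M0 H; rewrite [leLHS]/Num.Def.normr/= mx_normrE.
by apply: bigmax_le => // -[i j] _; rewrite /= ord1.
Qed.

Definition partial_grad f x : 'rV[R]_d -> R :=
  fun v => \sum_j v 0 j * 'D_(ei j) f x.

Lemma partial_grad_linear f x : linear (partial_grad f x).
Proof.
move=> a u v; rewrite /partial_grad scaler_sumr -big_split/=.
by apply: eq_bigr => j _; rewrite !mxE mulrDl /GRing.scale/= mulrA.
Qed.

HB.instance Definition _ f x :=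
  GRing.isLinear.Build _ _ _ _ (partial_grad f x) (partial_grad_linear f x).

Lemma partial_grad_continuous f x : continuous (partial_grad f x).
Proof.
move=> v; apply: (@cvg_big R _ _ _ _ _ _ (nbhs v)) => [|j _].
  exact: add_continuous.
by apply: cvgMr_tmp; exact: coord_continuous.
Qed.

(** The increment is split into d moves along the coordinate axes. The mean value theorem turns each
    into a partial derivative at a point near x, which continuity compares with its value at x. *)
Lemma C1_littleo f x :
  (forall j, \forall y \near x, derivable f y (ei j)) ->
  (forall j, {for x, continuous (fun y => 'D_(ei j) f y)}) ->
  forall e : R, 0 < e -> \forall v \near (0 : 'rV[R]_d),
    `|f (v + x) - (f x + partial_grad f x v)| <= e * `|v|.
Proof.
move=> df cf _/posnumP[e].
(* Dividing by [d.+1] instead of [d] keeps the bound positive when [d = 0]. *)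
have e1 : 0 < e%:num / (d.+1)%:R by rewrite divr_gt0.
have [r /= r0 rP] : exists2 r, 0 < r & forall y, `|y - x| < r -> forall j,
    derivable f y (ei j) /\
    `|'D_(ei j) f y - 'D_(ei j) f x| <= e%:num / (d.+1)%:R.
  have : \forall y \near x, forall j, derivable f y (ei j) /\
    `|'D_(ei j) f y - 'D_(ei j) f x| <= e%:num / (d.+1)%:R.
    apply: (@filter_forall _ _ _ (nbhs x) (nbhs_filter x)) => j.
    have /cvgrPdist_le/(_ _ e1) cfj := cf j.
    by apply: filterS2 (df j) cfj => y dy; rewrite distrC.
  move=> /nbhs_normP[r r0 rP]; exists r => // y yr; apply: rP.
  by rewrite /= distrC.
near=> v.
have vr : `|v| < r.
  near: v; apply/(@nbhs_normP R 'rV[R]_d); exists r => // v /=.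
  by rewrite sub0r normrN.
(* Vertices of the staircase path from x, which is [y 0], to x + v, which is [y d]. *)
pose y k := x + \sum_(j < d | (j < k)%N) v 0 j *: ei j.
have yS (k : 'I_d) : y k.+1 = y k + v 0 k *: ei k.
  rewrite /y -addrA; congr (_ + _); rewrite addrC (bigD1 k)//=; congr (_ + _).
  apply: eq_bigl => j; rewrite ltnS leq_eqVlt.
  have [->|jk] := eqVneq j k; first by rewrite ltnn andbF.
  by rewrite (negPf jk : (j == k :> nat) = false) andbT.
have ynear (k : 'I_d) t : `|t| <= `|v 0 k| -> `|y k + t *: ei k - x| < r.
  move=> tv; apply: le_lt_trans vr; rewrite /y addrAC [x + _]addrC addrK.
  apply: rV_norm_le => // l; rewrite mxE summxE.
  under eq_bigr do rewrite !mxE eqxx/=.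
  rewrite !mxE eqxx/=; have [<-|lk] := eqVneq k l.
    rewrite big1 ?add0r; last first.
      by move=> j jk; case: eqVneq jk => [<-|]; rewrite ?ltnn ?mulr0.
    by rewrite mulr1 (le_trans tv) ?rV_le_norm.
  rewrite mulr0 addr0; have [lltk|] := boolP (l < k)%N.
    rewrite (bigD1 l)//= eqxx mulr1 big1 ?addr0 ?rV_le_norm// => j /andP[_ jl].
    by rewrite eq_sym (negPf jl) mulr0.
  move=> lnk; rewrite big1 ?normr0// => j jk.
  by case: eqVneq jk lnk => [->->//|]; rewrite mulr0.
have step (k : 'I_d) :
    `|f (y k.+1) - f (y k) - v 0 k * 'D_(ei k) f x| <=
      e%:num / (d.+1)%:R * `|v|.
  have [t tv] := @MVT_line R _ f (y k) (ei k) (v 0 k)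
    (fun t tv => (rP _ (ynear k t tv) k).1).
  rewrite -yS => ->; rewrite -mulrBr normrM mulrC.
  by apply: ler_pM => //; [exact: (rP _ (ynear k t tv) k).2|exact: rV_le_norm].
have -> : f (v + x) - (f x + partial_grad f x v) =
    \sum_(k < d) (f (y k.+1) - f (y k) - v 0 k * 'D_(ei k) f x).
  rewrite sumrB -(big_mkord xpredT (fun k => f (y k.+1) - f (y k))).
  rewrite telescope_sumr//.
  have -> : y 0 = x by rewrite /y big_pred0 ?addr0.
  have -> : y d = v + x.
    rewrite /y addrC; congr (_ + _); rewrite [RHS]row_sum_delta.
    by apply: eq_bigl => j; rewrite ltn_ord.
  by rewrite opprD addrA.
apply: le_trans (ler_norm_sum _ _ _) _.
apply: le_trans (_ : \sum_(k < d) e%:num / (d.+1)%:R * `|v| <= _).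
  by apply: ler_sum => k _; exact: step.
rewrite sumr_const card_ord -[_ *+ d]mulr_natr mulrAC ler_wpM2r//.
rewrite -mulrA ler_piMr// mulrC ler_pdivrMr ?mul1r ?ler_nat//.
Unshelve. all: by end_near. Qed.

Lemma C1_diff f x :
  (forall j, \forall y \near x, derivable f y (ei j)) ->
  (forall j, {for x, continuous (fun y => 'D_(ei j) f y)}) ->
  differentiable f x /\ 'd f x = partial_grad f x :> ('rV[R]_d -> R).
Proof.
move=> df cf.
have E : 'd f x = partial_grad f x :> ('rV[R]_d -> R).
  apply: diff_unique; first exact: partial_grad_continuous.
  by apply/eqaddoP => e e0; exact: C1_littleo.
split=> //; apply/diff_locallyP; rewrite E; split.
  exact: partial_grad_continuous.
by apply/eqaddoP => e e0; exact: C1_littleo.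
Qed.

Lemma C1_differentiable f x :
  (forall j, \forall y \near x, derivable f y (ei j)) ->
  (forall j, {for x, continuous (fun y => 'D_(ei j) f y)}) ->
  differentiable f x.
Proof. by move=> df cf; have [] := C1_diff df cf. Qed.

Lemma C1_derive f x v :
  (forall j, \forall y \near x, derivable f y (ei j)) ->
  (forall j, {for x, continuous (fun y => 'D_(ei j) f y)}) ->
  'D_v f x = \sum_j v 0 j * 'D_(ei j) f x.
Proof. by move=> df cf; have [dfx E] := C1_diff df cf; rewrite deriveE// E. Qed.

End C1.

(** * Closure properties of C^k functions *)

Section CkTheory.
Variables (R : realType) (d : nat).
Implicit Types (U V W : set 'rV[R]_d) (f g : 'rV[R]_d -> R) (x v : 'rV[R]_d).
Local Notation ei j := (delta_mx 0 j : 'rV[R]_d).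

Lemma Ck_continuous k U f x : Ck k U f -> U x -> {for x, continuous f}.
Proof. by case: k => [|k] [cf _]; exact: cf. Qed.

Lemma CkD k U f g : open U -> Ck k U f -> Ck k U g -> Ck k U (f + g).
Proof.
move=> oU Cf Cg; rewrite -[g]opprK; apply: CkB => //.
by rewrite -[- g]sub0r; apply: CkB => //; exact: Ck_cst.
Qed.

Lemma Ck_sum k U (I : Type) (r : seq I) (F : I -> 'rV[R]_d -> R) : open U ->
  (forall i, Ck k U (F i)) -> Ck k U (fun x => \sum_(i <- r) F i x).
Proof.
move=> oU CF; elim: r => [|i r IH].
  by apply: Ck_ext (Ck_cst k 0 oU) => // x _; rewrite big_nil.
by apply: Ck_ext (CkD oU (CF i) IH) => // x _; rewrite big_cons.
Qed.

Lemma Ck_local k U f :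
  (forall x, U x -> exists2 W, W x & Ck k W f) -> Ck k U f.
Proof.
elim: k f => [|k IH] f H /=.
  by split=> // x /H[W Wx CW]; exact: Ck_continuous CW Wx.
split=> [x /H[W Wx CW]|i]; first exact: Ck_continuous CW Wx.
split=> [x /H[W Wx [_ /(_ i)[dW _]]]|]; first exact: dW.
by apply: IH => x /H[W Wx [_ /(_ i)[_ CW]]]; exists W.
Qed.

Lemma is_derive_coord x v (j : 'I_d) : is_derive x v (fun x => x 0 j) (v 0 j).
Proof.
have df : derivable (fun x : 'rV[R]_d => x) x v by exact: derivable_id.
apply: DeriveDef; first by have /derivable_mxP := df; exact.
have := congr1 (fun M : 'rV[R]_d => M 0 j) (derive_mx df).
by rewrite derive_id mxE => ->.
Qed.

Lemma Ck_coord k U (j : 'I_d) : open U -> Ck k U (fun x => x 0 j).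
Proof.
case: k => [|k] oU; split=> //; try by move=> x _; exact: coord_continuous.
move=> i; split=> [x _|]; first by have [] := is_derive_coord x (ei i) j.
apply: Ck_ext (Ck_cst k (ei i 0 j) oU) => // x _.
by have [_ ->] := is_derive_coord x (ei i) j.
Qed.

Lemma Ck1_differentiable U f x : open U -> Ck 1 U f -> U x -> differentiable f x.
Proof.
move=> oU [_ df] Ux; apply: C1_differentiable => j; have [dj [cj _]] := df j.
  by apply: filterS dj _; exact: open_nbhs_nbhs.
exact: cj.
Qed.

Lemma Ck1_derive U f x v : open U -> Ck 1 U f -> U x ->
  'D_v f x = \sum_j v 0 j * 'D_(ei j) f x.
Proof.
move=> oU [_ df] Ux; apply: C1_derive => j; have [dj [cj _]] := df j.
  by apply: filterS dj _; exact: open_nbhs_nbhs.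
exact: cj.
Qed.

(** By the chain rule a partial derivative of the composite is a sum of products of some
    [D_j f \o t], covered by the induction hypothesis, with partial derivatives of t, which is
    smooth. *)
Lemma Ck_comp k U V f (t : 'rV[R]_d -> 'rV[R]_d) : open U -> open V ->
  (forall x, U x -> V (t x)) -> (forall j, smooth_on U (fun x => t x 0 j)) ->
  Ck k V f -> Ck k U (f \o t).
Proof.
move=> oU oV UV St.
have dt x : U x -> differentiable t x.
  move=> Ux; rewrite (_ : t = \sum_(j < d) (fun x => t x 0 j *: ei j)); last first.
    apply/funext => y; rewrite fct_sumE; exact: row_sum_delta.
  apply: differentiable_sum => j; apply: differentiableZl.
  exact: Ck1_differentiable oU (St j 1%N) Ux.
have ct l g x : Ck l V g -> U x -> {for x, continuous (g \o t)}.
  move=> Cg Ux; apply: continuous_comp; first exact/differentiable_continuous/dt.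
  by apply: Ck_continuous Cg _; exact: UV.
elim: k f => [|k IH] f Cf; first by split=> // x Ux; exact: ct Cf Ux.
have C1 : Ck 1 V f by case: Cf => cf df; split=> // i; have [di ci] := df i;
  split=> //; split=> // x Vx; exact: Ck_continuous ci Vx.
split=> [x Ux|i]; first exact: ct Cf Ux.
have dft x : U x -> differentiable (f \o t) x.
  move=> Ux; apply: differentiable_comp; first exact: dt.
  by apply: Ck1_differentiable oV C1 _; exact: UV.
split=> [x Ux|]; first exact/diff_derivable/dft.
apply: (@Ck_ext _ _ _ _ (fun x => \sum_j 'D_(ei j) f (t x) *
    'D_(ei i) (fun x => t x 0 j) x)) => // [x Ux|].
  rewrite [RHS]deriveE; last exact: dft.
  rewrite diff_comp; [|exact: dt|by apply: Ck1_differentiable oV C1 _; exact: UV].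
  rewrite /= -deriveE; last by apply: Ck1_differentiable oV C1 _; exact: UV.
  rewrite (Ck1_derive _ oV C1); last exact: UV.
  apply: eq_bigr => j _; rewrite mulrC; congr (_ * _).
  rewrite -deriveE; last exact: dt.
  by rewrite derive_mx ?mxE//; exact/diff_derivable/dt.
apply: Ck_sum => // j.
have Cj : Ck k U ((fun x => 'D_(ei j) f x) \o t).
  by apply: IH; have [_ /(_ j)[]] := Cf.
have Ctj : Ck k U (fun x => 'D_(ei i) (fun x => t x 0 j) x).
  by have [_ /(_ i)[]] := St j k.+1.
exact: (CkM oU Cj Ctj).
Qed.

Lemma is_derive_scalar_comp (s : R -> R) (s' : R) f x v : derivable f x v ->
  is_derive (f x) 1 s s' -> is_derive x v (s \o f) (s' * 'D_v f x).
Proof.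
move=> df ds.
have line (g : 'rV[R]_d -> R) l : is_derive x v g l <->
    is_derive (0 : R) 1 (fun t => g (x + t *: v)) l.
  have E : (fun h : R => h^-1 *: (((fun t => g (x + t *: v)) \o shift 0) (h *: 1) -
      g (x + 0 *: v))) = (fun h => h^-1 *: ((g \o shift x) (h *: v) - g x)).
    apply/funext => h /=; rewrite scale0r addr0 [h *: 1]mulr1 addr0.
    by rewrite [x + _]addrC.
  split=> -[dg gl]; apply: DeriveDef; move: dg gl;
    by rewrite /derivable /derive E.
apply/line; apply: is_derive1_comp; rewrite ?scale0r ?addr0//.
by apply/line; exact: DeriveDef.
Qed.

(** For s = f^(-1/2) one has D s = - (1/2) s^3 D f, a polynomial in s and D f, so the induction
    closes on s alone. *)
Lemma Ck_isqrt k U f : open U -> (forall x, U x -> 0 < f x) -> Ck k U f ->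
  Ck k U (fun x => (Num.sqrt (f x))^-1).
Proof.
move=> oU f0; elim: k f f0 => [|k IH] f f0 Cf.
  split=> // x Ux; apply: (@continuousV _ _ (fun x => Num.sqrt (f x))).
    by rewrite gt_eqF// sqrtr_gt0 f0.
  apply: continuous_comp; first exact: Ck_continuous Cf Ux.
  exact: sqrt_continuous.
have ds (y : R) : 0 < y -> is_derive y 1 (fun y => (Num.sqrt y)^-1)
    (- 2^-1 * ((Num.sqrt y)^-1 * ((Num.sqrt y)^-1 * (Num.sqrt y)^-1))).
  move=> y0; have s0 : Num.sqrt y != 0 by rewrite gt_eqF// sqrtr_gt0.
  have dsq := is_derive1_sqrt y0.
  apply: (trigger_derive (is_deriveV s0 dsq)).
  by rewrite /GRing.scale/=; field; rewrite s0.
have dF i x : U x -> is_derive x (ei i) (fun x => (Num.sqrt (f x))^-1)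
    (- 2^-1 * ((Num.sqrt (f x))^-1 * ((Num.sqrt (f x))^-1 * (Num.sqrt (f x))^-1))
      * 'D_(ei i) f x).
  move=> Ux; apply: (@is_derive_scalar_comp (fun y => (Num.sqrt y)^-1)).
    by have [_ /(_ i)[dfi _]] := Cf; exact: dfi.
  by apply: ds; exact: f0.
have Ck' := IH f f0 (CkS Cf).
split=> [x Ux|i]; first exact: Ck_continuous Ck' Ux.
split=> [x Ux|]; first by have [] := dF i x Ux.
apply: (@Ck_ext _ _ _ _ (cst (- 2^-1) * ((fun x => (Num.sqrt (f x))^-1) *
  ((fun x => (Num.sqrt (f x))^-1) * (fun x => (Num.sqrt (f x))^-1))) *
  (fun x => 'D_(ei i) f x))) => // [x Ux|]; first by have [_ ->] := dF i x Ux.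
apply: CkM => //; last by have [_ /(_ i)[]] := Cf.
by do 3?[apply: CkM => //]; exact: Ck_cst.
Qed.

End CkTheory.

(** * The functions t^(-m) exp(-1/t), extended by zero *)

Section FlatFunction.
Variable R : realType.

(* These functions span a space closed under derivation, so smoothness of all
   of them is proved by a single induction. *)
Definition flat (m : nat) (t : R) : R :=
  if 0 < t then t^-1 ^+ m * expR (- t^-1) else 0.

Lemma flat_gt0 m t : 0 < t -> 0 < flat m t.
Proof. by move=> t0; rewrite /flat t0 mulr_gt0 ?expR_gt0// exprn_gt0// invr_gt0. Qed.

Lemma flat_eq0 m t : t <= 0 -> flat m t = 0.
Proof. by move=> t0; rewrite /flat ltNge t0. Qed.

Lemma flat_ge0 m t : 0 <= flat m t.
Proof.
by have [t0|t0] := leP t 0; [rewrite flat_eq0|rewrite ltW// flat_gt0].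
Qed.

(** With s = 1/t and N = m+1, exp s = (exp (s/N))^N >= (s/N)^N, one power of s more than the s^m to
    be beaten. *)
Lemma flat_le m t : 0 < t -> flat m t <= m.+1%:R ^+ m.+1 * t.
Proof.
move=> t0; rewrite /flat t0.
have s0 : 0 < t^-1 by rewrite invr_gt0.
have N0 : 0 < m.+1%:R :> R by rewrite ltr0n.
have le : (t^-1 / m.+1%:R) ^+ m.+1 <= expR t^-1.
  rewrite -[X in expR X](@divfK _ m.+1%:R) ?gt_eqF// expRM_natr.
  rewrite lerXn2r ?nnegrE ?expR_ge0 ?divr_ge0 ?ler0n//; do ?exact: ltW.
  by apply: le_trans (expR_ge1Dx _); rewrite lerDr.
rewrite expRN ler_pdivrMr ?expR_gt0// mulrAC.
apply: le_trans (_ : m.+1%:R ^+ m.+1 * (t^-1 / m.+1%:R) ^+ m.+1 * t <= _); last first.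
  by rewrite ler_wpM2r ?(ltW t0)// ler_wpM2l// exprn_ge0// ltW.
rewrite -exprMn mulrCA divff ?gt_eqF// mulr1 exprSr -mulrA mulVf ?gt_eqF// mulr1.
exact: lexx.
Qed.

Lemma is_derive_flat m (t : R) :
  is_derive t 1 (flat m) (- m%:R * flat m.+1 t + flat m.+2 t).
Proof.
have [t0|t0|->] := ltgtP t 0.
- rewrite !flat_eq0 ?(ltW t0)// mulr0 addr0.
  apply: near_eq_is_derive (is_derive_cst 0 t 1) => //.
  near=> y; rewrite flat_eq0//; apply: ltW; near: y.
  exact: (lt_nbhsl t0).
- have tn0 : t != 0 by rewrite gt_eqF.
  apply: (@near_eq_is_derive _ _ _ (fun y : R => y^-1 ^+ m * expR (- y^-1))).
  + by near=> y; rewrite /flat ifT//; near: y; exact: (lt_nbhsr t0).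
  have dV : is_derive t 1 (fun y : R => y^-1) (- t ^- 2).
    by apply: (trigger_derive (is_deriveV (f := id) tn0 (is_derive_id t 1)));
      rewrite [_ *: 1]mulr1.
  have dN : is_derive t 1 (fun y : R => - y^-1) (t ^- 2).
    by apply: (trigger_derive (is_deriveN dV)); rewrite opprK.
  have dE := @is_derive1_comp R expR (fun y => - y^-1) t _ _ (is_derive_expR _) dN.
  have dX := is_deriveX m dV.
  rewrite /flat t0.
  have -> : (fun y : R => y^-1 ^+ m * expR (- y^-1)) =
      ((fun y : R => y^-1) ^+ m) * (expR \o (fun y => - y^-1)).
    by apply/funext => y; rewrite !fctE.
  apply: (trigger_derive (is_deriveM dX dE)).
  rewrite !fctE /GRing.scale/= -!exprVn.
  case: m {dX} => [|m]; first by rewrite !mul0r mulr0; ring.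
  rewrite !exprS -[m.+1%:R]natr1; ring.
- rewrite !flat_eq0// mulr0 addr0.
  suff H : (fun h : R => h^-1 *: ((flat m \o shift 0) (h *: 1) - flat m 0)) h
      @[h --> 0^'] --> (0 : R).
    by apply: DeriveDef; [apply/cvg_ex; exists 0|apply/cvg_lim].
  apply/cvgrPdist_le => e e0; near=> h.
  rewrite sub0r normrN /= addr0 [h *: 1]mulr1 [flat m 0]flat_eq0// subr0.
  have [h0|h0] := leP h 0; first by rewrite flat_eq0// scaler0 normr0 ltW.
  (* For h > 0 the difference quotient at 0 belongs to the same family, and [flat_le] makes it tend
     to 0. *)
  have -> : h^-1 *: flat m h = flat m.+1 h.
    by rewrite /flat h0 exprS [LHS]mulrA.
  rewrite ger0_norm ?flat_ge0//; apply: le_trans (flat_le _ h0) _.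
  have C0 : 0 < m.+2%:R ^+ m.+2 :> R by rewrite exprn_gt0.
  rewrite mulrC -ler_pdivlMr//; apply: le_trans (ler_norm _) _.
  apply: ltW; near: h; apply: dnbhs0_lt; exact: divr_gt0.
Unshelve. all: by end_near. Qed.

Lemma Ck_flat (d k m : nat) (U : set 'rV[R]_d) f : open U -> Ck k U f ->
  Ck k U (flat m \o f).
Proof.
move=> oU; elim: k m f => [|k IH] m f Cf.
  split=> // x Ux; apply: continuous_comp; first exact: Ck_continuous Cf Ux.
  apply: differentiable_continuous; apply/derivable1_diffP.
  by have [] := is_derive_flat m (f x).
have dF i x : U x -> is_derive x (delta_mx 0 i) (flat m \o f)
    ((- m%:R * flat m.+1 (f x) + flat m.+2 (f x)) * 'D_(delta_mx 0 i) f x).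
  move=> Ux; apply: (is_derive_scalar_comp _ (is_derive_flat m (f x))).
  by have [_ /(_ i)[dfi _]] := Cf; exact: dfi.
have Ck' j := IH j f (CkS Cf).
split=> [x Ux|i]; first exact: Ck_continuous (Ck' m) Ux.
split=> [x Ux|]; first by have [] := dF i x Ux.
apply: (@Ck_ext _ _ _ _ ((cst (- m%:R) * (flat m.+1 \o f) + (flat m.+2 \o f)) *
  (fun x => 'D_(delta_mx 0 i) f x))) => // [x Ux|]; first by have [_ ->] := dF i x Ux.
apply: CkM => //; last by have [_ /(_ i)[]] := Cf.
by apply: CkD => //; apply: CkM => //; exact: Ck_cst.
Qed.

End FlatFunction.

(** * The second-derivative test at a maximum *)

Section MaximumTest.
Variable R : realType.

(** If c > 0, then g' is positive just to the right of 0, and the mean value theorem gives a t > 0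
    with g t > g 0. *)
Lemma max_derivative_test (g g1 : R -> R) (c : R) :
  (\forall t \near (0 : R), is_derive (t : R) 1 g (g1 t) /\ g t <= g 0) ->
  is_derive (0 : R) 1 g1 c -> g1 0 = 0 /\ c <= 0.
Proof.
move=> /nbhs_normP[r /= r0 rP] dg1.
have rP' (t : R) : `|t| < r -> is_derive t 1 g (g1 t) /\ g t <= g 0.
  by move=> tr; apply: rP; rewrite /= sub0r normrN.
have g10 : g1 0 = 0.
  have r0' : `|0 : R| < r by rewrite normr0.
  have [_ <-] := (rP' 0 r0').1.
  suff [] : is_derive (0 : R) 1 g 0 by [].
  apply: (@derive1_at_max _ g (- r) r 0).
  - by rewrite lerNl; lra.
  - move=> t; rewrite in_itv/= => tr; have [] := (rP' t _).1 => //.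
    by rewrite ltr_norml.
  - by rewrite in_itv/= oppr_lt0 r0.
  - by move=> t; rewrite in_itv/= => tr; apply: (rP' t _).2; rewrite ltr_norml.
split=> //; rewrite leNgt; apply/negP => c0.
have [dg1' vg1] := dg1.
have : (fun h : R => h^-1 *: ((g1 \o shift 0) (h *: 1) - g1 0)) h @[h --> 0^'] --> c.
  by rewrite -vg1; exact: dg1'.
move=> /cvgrPdist_lt/(_ _ c0) /nbhs_normP[s /= s0 sP].
pose t := Num.min r s / 2.
have m0 : 0 < Num.min r s by rewrite lt_min r0.
have t0 : 0 < t by rewrite divr_gt0.
have tm : t < Num.min r s by rewrite /t; lra.
have [tr ts] : t < r /\ t < s by move: tm; rewrite lt_min => /andP[].
have [||u] := @MVT R g g1 0 t t0.
- move=> u; rewrite in_itv/= => /andP[u0 ut]; apply: (rP' u _).1.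
  by rewrite gtr0_norm// (lt_trans ut).
- apply: continuous_in_subspaceT => u /set_mem/=; rewrite in_itv/= => /andP[u0 ut].
  apply: differentiable_continuous; apply/derivable1_diffP.
  have [] := (rP' u _).1 => //.
  by rewrite ger0_norm// (le_lt_trans ut).
rewrite in_itv/= => /andP[u0 ut]; rewrite subr0 => e.
have := (rP' t _).2; rewrite gtr0_norm// => /(_ tr).
apply/negP; rewrite -ltNge -subr_gt0 e mulr_gt0//.
have := sP u; rewrite /= sub0r normrN gtr0_norm// => /(_ (lt_trans ut ts)).
rewrite gt_eqF// => /(_ isT); rewrite addr0 [u *: 1]mulr1 g10 subr0.
move=> /ltr_normlP[_]; rewrite ltrBlDr => h.
have : 0 < u^-1 * g1 u by rewrite -[_ * _]/(u^-1 *: g1 u); lra.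
by rewrite pmulr_rgt0// invr_gt0.
Qed.

Variable d : nat.
Implicit Types (U : set 'rV[R]_d) (f : 'rV[R]_d -> R) (x v : 'rV[R]_d).

(** The test is applied to f along the line x + t v. The second derivative is left as a double sum
    of partial derivatives, the form into which coordinate fields of a manifold can be
    substituted. *)
Lemma Ck2_max_test U f x v : open U -> Ck 2 U f -> U x ->
  (forall y, U y -> f y <= f x) ->
  'D_v f x = 0 /\ \sum_i \sum_j v 0 i * v 0 j *
    'D_(delta_mx 0 i) (fun y => 'D_(delta_mx 0 j) f y) x <= 0.
Proof.
move=> oU C2 Ux fmax; have C1 := CkS C2.
pose l (t : R) := x + t *: v.
have lU : \forall t \near (0 : R), U (l t).
  have : {for 0, continuous l}.
    apply: differentiable_continuous.
    apply: (@differentiableD _ _ _ (cst x) (fun t : R => t *: v)).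
      exact: differentiable_cst.
    exact: (@differentiableZl _ _ _ (fun t : R => t)).
  by apply; rewrite /l scale0r addr0; exact: open_nbhs_nbhs.
pose Df := fun y => \sum_j v 0 j * 'D_(delta_mx 0 j) f y.
have CDf : Ck 1 U Df.
  apply: Ck_sum => // j; have [_ /(_ j)[_ Cj]] := C2.
  exact: (CkM oU (Ck_cst 1 (v 0 j) oU) Cj).
have [||] := @max_derivative_test (f \o l) (Df \o l) ('D_v Df x).
- near=> t; have Ut : U (l t) by near: t.
  split; last by rewrite /= {2}/l scale0r addr0; exact: fmax.
  rewrite /= /Df -(Ck1_derive v oU C1 Ut); apply: is_derive_line.
  exact: diff_derivable (Ck1_differentiable oU C1 Ut).
- have := @is_derive_line R _ Df x v 0; rewrite scale0r addr0; apply.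
  exact: diff_derivable (Ck1_differentiable oU CDf Ux).
rewrite /= /l scale0r addr0 => D0 D2; split; first by rewrite (Ck1_derive v oU C1).
apply: le_trans D2; rewrite (Ck1_derive v oU CDf)//.
rewrite le_eqVlt; apply/orP; left; apply/eqP; apply: eq_bigr => i _.
have dj j : derivable (fun y => 'D_(delta_mx 0 j) f y) x (delta_mx 0 i).
  by have [_ /(_ j)[_ [_ /(_ i)[di _]]]] := C2; exact: di.
rewrite /Df -fct_sumE derive_sum; last first.
  by move=> j; apply: derivableM => //; exact: derivable_cst.
rewrite mulr_sumr; apply: eq_bigr => j _.
rewrite -mulrA; congr (_ * _).
rewrite (@deriveM _ _ (cst (v 0 j)) (fun y => _)) ?derive_cst//.
by rewrite scaler0 addr0.
Unshelve. all: by end_near. Qed.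

End MaximumTest.

(** * Smooth functions and vector fields on a manifold *)

Section Charts.
Variables (R : realType) (d : nat) (X : topologicalType) (c : chart R d X).

Lemma cfwd_cts p : cdom c p -> {for p, continuous (cfwd c)}.
Proof.
move=> cp; have := @cfwd_continuous _ _ _ c.
rewrite (continuous_open_subspace _ (@cdom_open _ _ _ c)); apply.
exact/mem_set.
Qed.

Lemma cinv_cts x : (cfwd c @` cdom c) x -> {for x, continuous (cinv c)}.
Proof.
move=> cx; have := @cinv_continuous _ _ _ c.
rewrite (continuous_open_subspace _ (@cimg_open _ _ _ c)); apply.
exact/mem_set.
Qed.

Lemma cinv_dom x : (cfwd c @` cdom c) x -> cdom c (cinv c x).
Proof. by move=> [q cq <-]; rewrite cfwdK. Qed.

Lemma cinvK x : (cfwd c @` cdom c) x -> cfwd c (cinv c x) = x.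
Proof. by move=> [q cq <-]; rewrite cfwdK. Qed.

Lemma near_cinv p (P : set X) : cdom c p ->
  (\forall q \near p, P q) -> \forall x \near cfwd c p, P (cinv c x).
Proof.
move=> cp; rewrite -{1}(cfwdK cp) => nP.
by apply: (@cinv_cts (cfwd c p)) => //; exists p.
Qed.

Lemma near_cdom p : cdom c p -> \forall q \near p, cdom c q.
Proof. by move=> cp; apply: open_nbhs_nbhs; split=> //; exact: cdom_open. Qed.

Lemma cimg_sub_open (O : set X) : open O -> O `<=` cdom c -> open (cfwd c @` O).
Proof.
move=> oO Oc; rewrite openE => _ [p Op <-].
have cp := Oc p Op.
have nO : \forall q \near p, O q by exact: open_nbhs_nbhs.
have nV : \forall x \near cfwd c p, (cfwd c @` cdom c) x.
  by apply: open_nbhs_nbhs; split; [exact: cimg_open|exists p].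
apply: filterS2 (near_cinv cp nO) nV => x Ox Vx.
by exists (cinv c x) => //; exact: cinvK.
Qed.

End Charts.

(** * Cut-off functions and locality of vector fields *)

Section Smooth.
Variables (R : realType) (d : nat) (M : omanifold R d).
Implicit Types (f g h : Cinf M) (X Y : VF M) (p q : M) (c : chart R d M).

Lemma Cinf_ck f c k : atlas c -> Ck k (cfwd c @` cdom c) (f \o cinv c).
Proof. by case: f => f /= /asboolP Sf ac; exact: Sf. Qed.

Lemma Cinf_eq f g : (forall p, f p = g p) -> f = g.
Proof. by move=> fg; apply: val_inj; apply/funext. Qed.

Lemma CinfD f g p : (f + g) p = f p + g p. Proof. by []. Qed.
Lemma CinfB f g p : (f - g) p = f p - g p. Proof. by []. Qed.
Lemma CinfN f p : (- f) p = - f p. Proof. by []. Qed.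
Lemma CinfM f g p : (f * g) p = f p * g p. Proof. by []. Qed.
Lemma Cinf0 p : (0 : Cinf M) p = 0. Proof. by []. Qed.
Lemma Cinf1 p : (1 : Cinf M) p = 1. Proof. by []. Qed.
Lemma Cinf_scst a p : scst M a p = a. Proof. by []. Qed.
Lemma Cinf_sum (I : Type) (r : seq I) (P : pred I) (F : I -> Cinf M) p :
  (\sum_(i <- r | P i) F i) p = \sum_(i <- r | P i) F i p.
Proof. by elim/big_rec2: _ => // i y1 y2 _ <-. Qed.

Definition CinfE := (CinfD, CinfB, CinfN, CinfM, Cinf0, Cinf1, Cinf_scst).

Lemma Cinf_continuous f : continuous f.
Proof.
move=> p; have [c ac cp] := atlas_cover p.
have nE : \forall q \near p, (f \o cinv c \o cfwd c) q = f q.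
  by apply: filterS (near_cdom cp) => q cq /=; rewrite cfwdK.
rewrite /continuous_at -(nbhs_singleton nE).
apply: cvg_trans (near_eq_cvg nE) _.
apply: continuous_comp; first exact: cfwd_cts.
by apply: Ck_continuous (Cinf_ck f 0 ac) _; exists p.
Qed.

Definition zero_ext c (h : 'rV[R]_d -> R) : M -> R :=
  fun q => if q \in cdom c then h (cfwd c q) else 0.

(** The domain of c and the complement of K are open, as K is closed in M, and they cover M. On the
    first the extension is h composed with a transition map, on the second it vanishes. *)
Lemma zero_ext_smooth c (K : set M) (h : 'rV[R]_d -> R) :
  atlas c -> closed K -> K `<=` cdom c -> smooth_on (cfwd c @` cdom c) h ->
  (forall q, cdom c q -> ~ K q -> h (cfwd c q) = 0) ->
  zero_ext c h \in @smooth _ _ M.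
Proof.
move=> ac cK Kc Sh h0; apply/asboolP => c' ac' k.
apply: Ck_local => _ [q c'q <-].
have oI (O : set M) : open O -> open (cfwd c' @` (cdom c' `&` O)).
  move=> oO; apply: cimg_sub_open => [|r []//].
  by apply: openI => //; exact: cdom_open.
have [cq|ncq] := pselect (cdom c q).
  exists (cfwd c' @` (cdom c' `&` cdom c)); first by exists q.
  have [St _] := atlas_compatible ac' ac.
  have oW := oI _ (@cdom_open _ _ _ c).
  apply: (@Ck_ext _ _ _ _ (h \o (fun x => cfwd c (cinv c' x)))) => //.
    move=> _ [r [c'r cr] <-] /=; rewrite /zero_ext cfwdK// mem_set//.
  apply: (@Ck_comp _ _ _ _ (cfwd c @` cdom c)) => //; first exact: cimg_open.
  by move=> _ [r [c'r cr] <-]; rewrite cfwdK//; exists r.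
have oW := oI _ (closed_openC cK).
exists (cfwd c' @` (cdom c' `&` ~` K)); first by exists q => //; split=> // /Kc.
apply: Ck_ext (Ck_cst k 0 oW) => // _ [r [c'r nKr] <-].
rewrite /= /zero_ext cfwdK//; case: ifPn => // /set_mem cr.
by rewrite h0.
Qed.

Lemma flat_smooth m f : (flat m \o f : M -> R) \in @smooth _ _ M.
Proof.
apply/asboolP => c ac k.
by apply: Ck_flat (Cinf_ck f k ac); exact: cimg_open.
Qed.

Definition sflat m f : Cinf M := MkCinf (flat_smooth m f).

(** Here s = f^(-1/2), so that [s * s] serves as 1/f inside the ring of smooth functions. *)
Lemma isqrt_exists f : (forall p, 0 < f p) ->
  exists2 s : Cinf M, s * s * f = 1 & forall p, 0 < s p.
Proof.
move=> f0; have S : (fun p => (Num.sqrt (f p))^-1) \in @smooth _ _ M.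
  apply/asboolP => c ac k; apply: Ck_isqrt (Cinf_ck f k ac); first exact: cimg_open.
  by move=> x _; exact: f0.
exists (MkCinf S) => [|p]; last by rewrite /= invr_gt0 sqrtr_gt0.
apply: Cinf_eq => p; rewrite !CinfE /= -invfM -expr2 sqr_sqrtr ?(ltW (f0 p))//.
by rewrite mulVf// gt_eqF.
Qed.

Lemma precutoff p (O : set M) : nbhs p O ->
  exists F : Cinf M, exists K : set M, [/\ closed K, K `<=` O,
    forall q, 0 <= F q, 0 < F p & forall q, ~ K q -> F q = 0].
Proof.
move=> nO; have [c ac cp] := atlas_cover p.
have nV : \forall x \near cfwd c p, (cfwd c @` cdom c) x.
  by apply: open_nbhs_nbhs; split; [exact: cimg_open|exists p].
have [r /= r0 rP] := (@nbhs_normP R 'rV[R]_d _ _).1 (filterI (near_cinv cp nO) nV).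
pose r2 := r / 2.
have r20 : 0 < r2 by rewrite divr_gt0.
pose x0 := cfwd c p.
(* A closed cube of half-side [r2]. Its image K in M is compact, hence closed because M is
   Hausdorff. The bump [h] is built from the squared Euclidean distance [N], which is smooth, and is
   supported in the inscribed ball. *)
pose C := [set x : 'rV[R]_d | forall i, `[x0 0 i - r2, x0 0 i + r2]%classic (x ord0 i)].
have cC : compact C.
  apply: (@rV_compact _ _ (fun i => `[x0 0 i - r2, x0 0 i + r2]%classic)) => i.
  exact: segment_compact.
have CP x : C x -> O (cinv c x) /\ (cfwd c @` cdom c) x.
  move=> Cx; apply: rP => /=; apply: (@le_lt_trans _ _ r2); last by rewrite /r2; lra.
  apply: rV_norm_le => [|j]; first exact: ltW.
  have /= := Cx j; rewrite in_itv/= !mxE => /andP[h1 h2].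
  by rewrite distrC ler_distl; apply/andP; split; lra.
pose K := cinv c @` C.
have cK : closed K.
  apply: compact_closed; first exact: m_hausdorff.
  apply: continuous_compact => //; apply: continuous_in_subspaceT => x /set_mem Cx.
  exact: cinv_cts (CP x Cx).2.
have KO : K `<=` O by move=> _ [x Cx <-]; exact: (CP x Cx).1.
have Kc : K `<=` cdom c by move=> _ [x Cx <-]; exact: cinv_dom (CP x Cx).2.
pose N (x : 'rV[R]_d) := \sum_i (x 0 i - x0 0 i) * (x 0 i - x0 0 i).
pose h := flat 0 \o (cst (r2 ^+ 2) - N).
have Sh : smooth_on (cfwd c @` cdom c) h.
  move=> k; have oV := @cimg_open _ _ _ c.
  apply: Ck_flat => //; apply: CkB; [exact: oV|exact: Ck_cst|].
  apply: Ck_sum => // i.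
  have C1 : Ck k (cfwd c @` cdom c) ((fun x : 'rV[R]_d => x 0 i) - cst (x0 0 i)).
    by apply: CkB; [exact: oV|exact: Ck_coord|exact: Ck_cst].
  exact: (CkM oV C1 C1).
have h0 q : cdom c q -> ~ K q -> h (cfwd c q) = 0.
  move=> cq nKq; apply: flat_eq0; rewrite /= subr_le0 leNgt; apply/negP => lt.
  apply: nKq; exists (cfwd c q); last exact: cfwdK.
  move=> i; rewrite /= in_itv/=.
  have : (cfwd c q 0 i - x0 0 i) ^+ 2 < r2 ^+ 2.
    apply: le_lt_trans lt; rewrite /N (bigD1 i)//= -expr2 lerDl.
    by apply: sumr_ge0 => j _; rewrite -expr2 sqr_ge0.
  rewrite -ltr_sqrt ?exprn_gt0// !sqrtr_sqr (gtr0_norm r20).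
  by rewrite ltr_distl => /andP[h1 h2]; apply/andP; split; apply: ltW.
have S := zero_ext_smooth ac cK Kc Sh h0.
exists (MkCinf S), K; split=> //= [q||q nKq]; rewrite /zero_ext.
- by case: ifP => // _; exact: flat_ge0.
- rewrite mem_set//; apply: flat_gt0.
  have -> : (cst (r2 ^+ 2) - N) (cfwd c p) = r2 ^+ 2; last exact: exprn_gt0.
  by rewrite !fctE /N big1 ?subr0// => i _; rewrite subrr mul0r.
- by case: ifP => // /set_mem cq; exact: h0.
Qed.

(** The function is u / (u + v), with u > 0 exactly where F > a and v > 0 exactly where F < 2a, so
    the denominator never vanishes. Since F p = 3a, v is zero near p and the quotient is 1 there;
    off K, F and hence u are zero. *)
Lemma cutoff p (O : set M) : nbhs p O ->
  exists b : Cinf M, exists K : set M, [/\ closed K, K `<=` O,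
    forall q, 0 <= b q <= 1, \forall q \near p, b q = 1 &
    forall q, ~ K q -> b q = 0].
Proof.
move=> /precutoff[F [K [cK KO F0 Fp FK]]].
pose a := F p / 3.
have a0 : 0 < a by rewrite divr_gt0.
pose u := sflat 0 (F - scst M a).
pose v := sflat 0 (scst M (2 * a) - F).
have u0 q : 0 <= u q by exact: flat_ge0.
have v0 q : 0 <= v q by exact: flat_ge0.
have [|s sE s0] := @isqrt_exists (u + v).
  move=> q; rewrite !CinfE; have [Fq|Fq] := ltP (F q) (2 * a).
    by apply: ltr_wpDl => //; apply: flat_gt0; rewrite !CinfE; lra.
  by apply: ltr_pwDl => //; apply: flat_gt0; rewrite !CinfE; lra.
have sE' q : s q * s q * (u q + v q) = 1 by have := congr1 (fun f : Cinf M => f q) sE.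
exists (s * s * u), K; split=> //.
- move=> q; rewrite !CinfE; apply/andP; split; first by rewrite !mulr_ge0// ltW.
  by rewrite -(sE' q) ler_wpM2l ?lerDl// mulr_ge0// ltW.
- have nF : \forall q \near p, 2 * a < F q.
    by apply: (cvgr_gt _ (@Cinf_continuous F p)); rewrite /a; lra.
  apply: filterS nF => q Fq; rewrite !CinfE -(sE' q) [v q]flat_eq0 ?addr0//.
  by rewrite !CinfE; lra.
- move=> q nKq; rewrite !CinfE [u q]flat_eq0 ?mulr0//.
  by rewrite !CinfE FK//; lra.
Qed.

Lemma VF_add X f g : X (f + g) = X f + X g.
Proof. by have /asboolP[D _ _] := valP X; exact: D. Qed.
Lemma VF_scst X a f : X (scst M a * f) = scst M a * X f.
Proof. by have /asboolP[_ D _] := valP X; exact: D. Qed.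
Lemma VF_mul X f g : X (f * g) = f * X g + g * X f.
Proof. by have /asboolP[_ _ D] := valP X; exact: D. Qed.
Lemma scst0 : scst M 0 = 0. Proof. exact: Cinf_eq. Qed.
Lemma scst1 : scst M 1 = 1. Proof. exact: Cinf_eq. Qed.
Lemma scstN a : scst M (- a) = - scst M a. Proof. exact: Cinf_eq. Qed.
Lemma scstD a b : scst M (a + b) = scst M a + scst M b. Proof. exact: Cinf_eq. Qed.
Lemma VF_0 X : X 0 = 0.
Proof. by rewrite -[0 in LHS](mul0r 0) -scst0 VF_scst scst0 mul0r. Qed.
Lemma VF_N X f : X (- f) = - X f.
Proof. by rewrite -mulN1r -scst1 -scstN VF_scst scstN scst1 mulN1r. Qed.
Lemma VF_sub X f g : X (f - g) = X f - X g.
Proof. by rewrite VF_add VF_N. Qed.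
Lemma VF_sum X (I : Type) (r : seq I) (P : pred I) (F : I -> Cinf M) :
  X (\sum_(i <- r | P i) F i) = \sum_(i <- r | P i) X (F i).
Proof. by elim/big_rec2: _ => [|i y1 y2 _ <-]; rewrite ?VF_0 ?VF_add. Qed.
Lemma VF_1 X : X 1 = 0.
Proof.
have := VF_mul X 1 1; rewrite !mul1r => /(congr1 (fun f => f - X 1)).
by rewrite subrr addrK.
Qed.
Lemma VF_cst X a : X (scst M a) = 0.
Proof. by rewrite -[scst M a]mulr1 VF_scst VF_1 mulr0. Qed.

Lemma VF_eq X Y : (forall f p, X f p = Y f p) -> X = Y.
Proof.
by move=> XY; apply: val_inj; apply/funext => f; apply: Cinf_eq => p; exact: XY.
Qed.

(** For a cut-off b supported where f = g, the product (f - g) b is identically zero; expanding X of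
    it by Leibniz at p leaves X (f - g) p, as b is 1 and f - g is 0 there. *)
Lemma VF_near X f g p : (\forall q \near p, f q = g q) -> X f p = X g p.
Proof.
move=> /[dup] nfg /cutoff[b [K [_ KO _ nb b0]]].
have bp := nbhs_singleton nb.
have E : (f - g) * b = 0.
  apply: Cinf_eq => q; rewrite !CinfE; have [/KO->|/b0->] := pselect (K q).
    by rewrite subrr mul0r.
  by rewrite mulr0.
have := congr1 (fun h : Cinf M => h p) (VF_mul X (f - g) b).
rewrite E VF_0 !CinfE (nbhs_singleton nfg) subrr mul0r add0r bp mul1r VF_sub CinfB.
by move=> /esym/eqP; rewrite subr_eq0 => /eqP.
Qed.

(** The function b h + (1 - b) is positive everywhere and agrees with h near p. This is what
    normalizes a field that is nonzero only near a point. *)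
Lemma local_isqrt h p : 0 < h p ->
  exists s : Cinf M, \forall q \near p, (s * s * h) q = 1.
Proof.
move=> hp; have nh : \forall q \near p, 0 < h q.
  exact: (cvgr_gt _ (@Cinf_continuous h p)).
have [b [K [_ KO b01 nb b0]]] := cutoff nh.
have [|s sE _] := @isqrt_exists (b * h + (1 - b)).
  move=> q; rewrite !CinfE; have [/KO hq|/b0->] := pselect (K q); last first.
    by rewrite mul0r subr0 add0r.
  have /andP[bq0 bq1] := b01 q.
  move: bq0; rewrite le_eqVlt => /predU1P[<-|bq0]; first by rewrite mul0r subr0 add0r.
  by apply: ltr_pwDl; rewrite ?mulr_gt0// subr_ge0.
exists s; apply: filterS nb => q bq.
have := congr1 (fun f : Cinf M => f q) sE.
by rewrite !CinfE bq mul1r subrr addr0.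
Qed.

End Smooth.


(** * Globally defined coordinates and coordinate fields *)

Section LocalCoordinates.
Variables (R : realType) (d : nat) (M : omanifold R d).
Implicit Types (f g h : Cinf M) (X Y : VF M) (p q : M).
Local Notation ei j := (delta_mx 0 j : 'rV[R]_d).

Lemma Cinf_derivable f (c : chart R d M) x v : atlas c -> (cfwd c @` cdom c) x ->
  derivable (f \o cinv c) x v.
Proof.
move=> ac Vx; apply: diff_derivable.
exact: Ck1_differentiable (@cimg_open _ _ _ c) (Cinf_ck f 1 ac) Vx.
Qed.

(** Chart coordinates and coordinate fields are multiplied by a cut-off to become global, so they
    are dual to each other only near p. The last clause is the second-derivative test of the chart
    read through these fields. *)
Lemma local_coordinates p : exists (x : 'I_d -> Cinf M) (D : 'I_d -> VF M),
  (\forall q \near p, forall i j, D i (x j) q = (i == j)%:R) /\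
  forall f, (forall q, f q <= f p) -> (forall j, D j f p = 0) /\
    forall xi : 'I_d -> R, \sum_i \sum_j xi i * xi j * D i (D j f) p <= 0.
Proof.
have [c ac cp] := atlas_cover p.
have [b [K [cK KO b01 nb b0]]] := cutoff (near_cdom cp).
pose V := cfwd c @` cdom c.
have oV : open V by exact: cimg_open.
have ext_ex (h : 'rV[R]_d -> R) : smooth_on V h -> exists F : Cinf M,
    forall q, F q = if q \in cdom c then b q * h (cfwd c q) else 0.
  move=> Sh; have S : smooth_on V ((b \o cinv c) * h).
    by move=> k; exact: (CkM oV (Cinf_ck b k ac) (Sh k)).
  have S0 q : cdom c q -> ~ K q -> ((b \o cinv c) * h) (cfwd c q) = 0.
    by move=> cq nKq; rewrite !fctE /= cfwdK// b0// mul0r.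
  exists (MkCinf (zero_ext_smooth ac cK KO S S0)) => q /=.
  by rewrite /zero_ext; case: ifP => // /set_mem cq; rewrite !fctE /= cfwdK.
have [Dfun DfunE] : exists Dfun : 'I_d -> Cinf M -> Cinf M, forall i f q,
    Dfun i f q = if q \in cdom c then b q * 'D_(ei i) (f \o cinv c) (cfwd c q) else 0.
  have H (u : 'I_d * Cinf M) : exists F : Cinf M, forall q,
      F q = if q \in cdom c then b q * 'D_(ei u.1) (u.2 \o cinv c) (cfwd c q) else 0.
    have S : smooth_on V (fun y => 'D_(ei u.1) (u.2 \o cinv c) y).
      by move=> k; have [_ /(_ u.1)[]] := Cinf_ck u.2 k.+1 ac.
    exact: ext_ex S.
  have [F FE] := choice H.
  by exists (fun i f => F (i, f)) => i f; exact: FE (i, f).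
have der i : (Dfun i : Cinf M -> (Cinf M)^o) \in @derivation _ _ M.
  apply/asboolP; split=> [f g|a f|f g]; apply: Cinf_eq => q;
    rewrite !(CinfE, DfunE); case: ifP => [/set_mem cq|_].
  - have Vq : V (cfwd c q) by exists q.
    rewrite (deriveD (f := f \o cinv c) (g := g \o cinv c)) ?mulrDr//;
      exact: Cinf_derivable.
  - by rewrite addr0.
  - have Vq : V (cfwd c q) by exists q.
    rewrite (deriveM (f := cst a) (g := f \o cinv c)); last 2 first.
    + exact: derivable_cst.
    + exact: Cinf_derivable.
    by rewrite derive_cst scaler0 addr0 mulrCA.
  - by rewrite mulr0.
  - have Vq : V (cfwd c q) by exists q.
    rewrite (deriveM (f := f \o cinv c) (g := g \o cinv c)); last 2 first.
    + exact: Cinf_derivable.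
    + exact: Cinf_derivable.
    by rewrite /GRing.scale/= cfwdK//; ring.
  - by rewrite !mulr0 addr0.
have [x xE] : exists x : 'I_d -> Cinf M, forall i q,
    x i q = if q \in cdom c then b q * (cfwd c q) 0 i else 0.
  have H i : exists F : Cinf M, forall q,
      F q = if q \in cdom c then b q * (cfwd c q) 0 i else 0.
    have S : smooth_on V (fun y : 'rV[R]_d => y 0 i) by move=> k; exact: Ck_coord.
    exact: ext_ex S.
  by have [x xE] := choice H; exists x.
have near1 q : cdom c q -> (\forall r \near q, b r = 1) ->
    forall f i, \forall r \near q, Dfun i f r = 'D_(ei i) (f \o cinv c) (cfwd c r).
  move=> cq nbq f i; apply: filterS2 (near_cdom cq) nbq => r cr br.
  by rewrite DfunE mem_set// br mul1r.
exists x, (fun i => MkVF (der i)); split.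
  (* Differentiating [x j] at q requires the cut-off to be 1 on a neighbourhood of q, not merely at
     q. *)
  have nbb : \forall q \near p, \forall r \near q, b r = 1.
    exact: nbhs_interior nb.
  apply: filterS2 (near_cdom cp) nbb => q cq nbq i j.
  rewrite /= (nbhs_singleton (near1 q cq nbq (x j) i)).
  have nE : \forall y \near cfwd c q, (fun y : 'rV[R]_d => y 0 j) y = (x j \o cinv c) y.
    have nV : \forall y \near cfwd c q, V y.
      by apply: open_nbhs_nbhs; split=> //; exists q.
    apply: filterS2 nV (near_cinv cq nbq) => y Vy by1 /=.
    by rewrite xE mem_set ?by1 ?mul1r ?cinvK//; exact: cinv_dom.
  rewrite -(near_eq_derive _ nE).
  have [_ ->] := is_derive_coord (cfwd c q) (ei i) j.
  by rewrite mxE eqxx eq_sym.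
move=> f fmax.
have C2 := Cinf_ck f 2 ac.
have Vp : V (cfwd c p) by exists p.
have bp := nbhs_singleton nb.
have fmax' y : V y -> (f \o cinv c) y <= (f \o cinv c) (cfwd c p).
  by move=> _; rewrite /= [in leRHS]cfwdK.
split=> [j|xi].
  rewrite /= (nbhs_singleton (near1 p cp nb f j)).
  by have [] := Ck2_max_test (ei j) oV C2 Vp fmax'.
have [_] := Ck2_max_test (\row_i xi i) oV C2 Vp fmax'.
apply: le_trans; rewrite le_eqVlt; apply/orP; left; apply/eqP.
apply: eq_bigr => i _; apply: eq_bigr => j _; rewrite !mxE; congr (_ * _).
rewrite /= (nbhs_singleton (near1 p cp nb _ i)); apply: near_eq_derive.
have nV : \forall y \near cfwd c p, V y by exact: open_nbhs_nbhs.
apply: filterS2 nV (near_cinv cp (near1 p cp nb f j)) => y Vy /= ->.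
by rewrite cinvK.
Qed.

End LocalCoordinates.

(** * Tangent spaces, tensoriality and the maximum test for fields *)

Section Tangent.
Variables (R : realType) (d : nat) (M : omanifold R d).
Implicit Types (f g h : Cinf M) (X Y : VF M) (p q : M).

Definition spanned_at p (I : finType) (e : I -> VF M) X :=
  exists a : I -> R, forall f, X f p = \sum_i a i * e i f p.

Lemma VFD X Y f : (X + Y) f = X f + Y f. Proof. by []. Qed.
Lemma VFN X f : (- X) f = - X f. Proof. by []. Qed.
Lemma VFB X Y f : (X - Y) f = X f - Y f. Proof. by []. Qed.
Lemma VFZ h X f : (h *: X) f = h * X f. Proof. by []. Qed.
Lemma VF0 f : (0 : VF M) f = 0. Proof. by []. Qed.
Lemma VFsum (I : Type) (r : seq I) (P : pred I) (F : I -> VF M) f :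
  (\sum_(i <- r | P i) F i) f = \sum_(i <- r | P i) F i f.
Proof. by elim/big_rec2: _ => // i y1 y2 _ <-. Qed.
Definition VFE := (VFD, VFN, VFB, VFZ, VF0, VFsum).

(* Every tangent space is spanned by d global fields; together with the d
   independent coordinate fields this forces derivations to be determined by
   their values on coordinates, without Hadamard's lemma. *)
Hypothesis frames : forall q, exists e : 'I_d -> VF M, forall X, spanned_at q e X.

Lemma coordinate_expansion q (x : 'I_d -> Cinf M) (D : 'I_d -> VF M) :
  (forall i j, D i (x j) q = (i == j)%:R) ->
  forall X f, X f q = \sum_j X (x j) q * D j f q.
Proof.
move=> Dx X f; have [e eP] := frames q.
have [C CP] := choice (fun i => eP (D i)).
pose A : 'M[R]_d := \matrix_(i, k) C i k.
pose B : 'M[R]_d := \matrix_(k, j) e k (x j) q.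
have AB : A *m B = 1%:M.
  apply/matrixP => i j; rewrite !mxE -Dx CP; apply: eq_bigr => k _.
  by rewrite !mxE.
(* A expresses the [D i] in the [e k], and B evaluates the [e k] on coordinates. Both are square, so
   B also inverts A from the left: each [e k] expands in the [D j], and so does every field. *)
have BA : B *m A = 1%:M := mulmx1C AB.
have eD k : e k f q = \sum_j e k (x j) q * D j f q.
  under eq_bigr do rewrite CP mulr_sumr.
  rewrite exchange_big/= (bigD1 k)//= [X in _ = X + _](_ : _ = e k f q); last first.
    under eq_bigr do rewrite mulrA; rewrite -mulr_suml.
    have /matrixP/(_ k k) := BA; rewrite !mxE eqxx/=.
    by under eq_bigr do rewrite !mxE; move=> ->; rewrite mul1r.
  rewrite big1 ?addr0// => l lk; under eq_bigr do rewrite mulrA; rewrite -mulr_suml.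
  have /matrixP/(_ k l) := BA; rewrite !mxE eq_sym (negPf lk).
  by under eq_bigr do rewrite !mxE; move=> ->; rewrite mul0r.
have [a aP] := eP X; rewrite aP.
under eq_bigr do rewrite eD mulr_sumr.
rewrite exchange_big/=; apply: eq_bigr => j _; rewrite aP mulr_suml.
by apply: eq_bigr => k _; rewrite mulrA.
Qed.

(** The cut-off turns the pointwise expansion of X into the global identity b X = sum_j b X(x_j)
    D_j, to which linearity over smooth functions applies; its coefficients vanish at p. *)
Lemma linear_tensorial (a : VF M -> Cinf M) X p :
  (forall X Y, a (X + Y) = a X + a Y) -> (forall h X, a (h *: X) = h * a X) ->
  (forall f, X f p = 0) -> a X p = 0.
Proof.
move=> aD aZ Xp; have [x [D [nD _]]] := local_coordinates p.
have [b [K [_ KO _ nb b0]]] := cutoff nD.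
have bp := nbhs_singleton nb.
have E : b *: X = \sum_j (b * X (x j)) *: D j.
  apply: VF_eq => f q; rewrite !VFE Cinf_sum CinfM.
  under eq_bigr do rewrite VFZ !CinfM -mulrA.
  rewrite -mulr_sumr; have [Kq|/b0->] := pselect (K q); last by rewrite !mul0r.
  by congr (_ * _); apply: coordinate_expansion; exact: KO.
have a0 : a 0 = 0 by rewrite -(scale0r (0 : VF M)) aZ mul0r.
have : a (b *: X) p = 0.
  rewrite E (big_morph a aD a0) Cinf_sum big1// => j _.
  by rewrite aZ !CinfM Xp mulr0 mul0r.
by rewrite aZ CinfM bp mul1r.
Qed.

(** First derivatives vanish at the maximum, so in X (X f) the terms X (X x_j) D_j f drop out and
    only the quadratic form of the coordinate test remains, at the vector with components
    X(x_j)(p). *)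
Lemma VF_max_test f p : (forall q, f q <= f p) ->
  forall X, X f p = 0 /\ X (X f) p <= 0.
Proof.
move=> fmax X; have [x [D [nD /(_ f fmax)[D0 D2]]]] := local_coordinates p.
have Ep := coordinate_expansion (nbhs_singleton nD).
split; first by rewrite Ep big1// => j _; rewrite D0 mulr0.
have nE : \forall q \near p, X f q = (\sum_j X (x j) * D j f) q.
  apply: filterS nD => q /coordinate_expansion ->; rewrite Cinf_sum.
  by apply: eq_bigr.
rewrite (VF_near X nE) VF_sum Cinf_sum.
apply: le_trans (D2 (fun j => X (x j) p)); rewrite exchange_big/=.
rewrite le_eqVlt; apply/orP; left; apply/eqP.
apply: eq_bigr => j _; rewrite VF_mul !CinfE D0 mul0r addr0 (Ep X (D j f)) mulr_sumr.
by apply: eq_bigr => i _; rewrite mulrA [_ * X (x i) p]mulrC.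
Qed.

(** Otherwise the identity matrix of size d would factor through m < d columns. It supplies the next
    vector in the Gram-Schmidt construction. *)
Lemma not_spanned p m (e : 'I_m -> VF M) : (m < d)%N ->
  exists X, ~ spanned_at p e X.
Proof.
move=> md; have [x [D [nD _]]] := local_coordinates p.
have Dx := nbhs_singleton nD.
apply: contrapT => /forallNP H.
have S j : spanned_at p e (D j) by apply: contrapT; exact: H.
have [C CP] := choice S.
pose A : 'M[R]_(d, m) := \matrix_(i, k) C i k.
pose B : 'M[R]_(m, d) := \matrix_(k, j) e k (x j) p.
have AB : A *m B = 1%:M.
  apply/matrixP => i j; rewrite !mxE -Dx CP; apply: eq_bigr => k _.
  by rewrite !mxE.
have := mulmx_max_rank A B; rewrite AB mxrank1.
by rewrite leqNgt md.
Qed.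

Lemma spanned_of_free p (e : 'I_d -> VF M) :
  (forall a : 'I_d -> R, (forall f, \sum_i a i * e i f p = 0) -> forall i, a i = 0) ->
  forall X, spanned_at p e X.
Proof.
move=> free X; have [x [D [nD _]]] := local_coordinates p.
have Ep := coordinate_expansion (nbhs_singleton nD).
pose B : 'M[R]_d := \matrix_(k, j) e k (x j) p.
have Bfree : row_free B.
  apply/row_freeP; apply: contrapT => nB.
  have : kermx B != 0 by rewrite kermx_eq0; apply/row_freeP.
  move=> /rowV0Pn[v /sub_kermxP vB /eqP]; apply; apply/rowP => i; rewrite mxE.
  apply: (free (fun i => v 0 i)) => f.
  under eq_bigr do rewrite Ep mulr_sumr.
  rewrite exchange_big/= big1// => j _; under eq_bigr do rewrite mulrA.
  rewrite -mulr_suml; have /rowP/(_ j) := vB; rewrite !mxE.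
  by under eq_bigr do rewrite mxE; move=> ->; rewrite mul0r.
have /submxP[a aE] : (\row_j X (x j) p <= B)%MS.
  by apply: submx_full; rewrite row_full_unit -row_free_unit.
exists (fun i => a 0 i) => f; rewrite Ep.
under [RHS]eq_bigr do rewrite Ep mulr_sumr.
rewrite exchange_big/=; apply: eq_bigr => j _; under eq_bigr do rewrite mulrA.
rewrite -mulr_suml; congr (_ * _).
have /rowP/(_ j) := aE; rewrite !mxE => ->.
by apply: eq_bigr => i _; rewrite !mxE.
Qed.

End Tangent.

(** * CR structures *)

Section CRFrames.
Variables (R : realType) (n : nat) (M : omanifold R n.*2.+1) (E : CR_structure M n).
Implicit Types (f g h : Cinf M) (X Y : VF M) (p q : M).
Local Notation Re := complex.Re.
Local Notation Im := complex.Im.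
Local Open Scope complex_scope.

Lemma ReIm_sum (I : finType) (F : I -> R[i]) :
  Re (\sum_i F i) = \sum_i Re (F i) /\ Im (\sum_i F i) = \sum_i Im (F i).
Proof.
elim/big_rec3: _ => [|i a b z _ [<- <-]]; first by [].
by case: (F i) z => [? ?] [? ?].
Qed.

Lemma T10_span q : exists Z : 'I_n -> CVF M,
  E q = [set w | exists c : 'I_n -> R[i],
    forall f, w f = \sum_i c i * cvf_at q (Z i) f].
Proof.
by have [Z nZ] := T10_subbundle E q; exists Z; have [] := nbhs_singleton nZ.
Qed.

Lemma T10_lin q w1 w2 c : E q w1 -> E q w2 -> E q (fun f => c * w1 f + w2 f).
Proof.
have [Z ->] := T10_span q => -[c1 H1] [c2 H2]; exists (fun i => c * c1 i + c2 i) => f.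
by rewrite H1 H2 mulr_sumr -big_split/=; apply: eq_bigr => i _; rewrite mulrDl mulrA.
Qed.

Lemma T10_0 q : E q (fun=> 0).
Proof.
have [Z ->] := T10_span q; exists (fun=> 0) => f.
by rewrite big1// => i _; rewrite mul0r.
Qed.

Lemma HbundleP q v : Hbundle E q v <-> exists2 w, E q w & forall f, v f = Re (w f).
Proof.
split=> [[Z [W [EZ EW vE]]]|[w Ew vE]].
  exists (fun f => 1 * Z f + W f); first exact: T10_lin.
  by move=> f; rewrite vE /ctan_conj mul1r; case: (Z f) (W f) => [? ?] [? ?].
exists w, (fun=> 0); split=> // [|f]; first exact: T10_0.
by rewrite vE /ctan_conj; case: (w f) => a b /=; rewrite addr0.
Qed.

(** The value w is extended with constant coefficients in a local frame and multiplied by a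
    cut-off. *)
Lemma T10_section q w : E q w -> exists2 W, is_section E W & cvf_at q W = w.
Proof.
move=> Ew; have [Z nZ] := T10_subbundle E q.
have [c cE] : exists c : 'I_n -> R[i], forall f, w f = \sum_i c i * cvf_at q (Z i) f.
  by have [_ Eq] := nbhs_singleton nZ; rewrite Eq in Ew.
have [b [K [_ KO _ nb b0]]] := cutoff nZ.
pose W : CVF M :=
  (\sum_i ((b * scst M (Re (c i))) *: (Z i).1 - (b * scst M (Im (c i))) *: (Z i).2),
   \sum_i ((b * scst M (Re (c i))) *: (Z i).2 + (b * scst M (Im (c i))) *: (Z i).1)).
have WE r f : cvf_at r W f = (b r)%:C * \sum_i c i * cvf_at r (Z i) f.
  have [] := ReIm_sum (fun i => c i * cvf_at r (Z i) f).
  set S := \sum_i c i * _ => S1 S2.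
  have -> : cvf_at r W f = W.1 f r +i* W.2 f r by [].
  apply/eqP; rewrite eq_complex; case: S S1 S2 => S1 S2 /= -> ->.
  rewrite !VFsum !Cinf_sum !mul0r subr0 addr0 !mulr_sumr.
  apply/andP; split; apply/eqP; apply: eq_bigr => i _; rewrite !VFE !CinfE;
    case: (c i) => a b1 /=; ring.
exists W; last first.
  apply/funext => f; rewrite WE (nbhs_singleton nb) cE.
  by rewrite -[1%:C]/(1 : R[i]) mul1r.
move=> r.
rewrite (_ : cvf_at r W = fun f => (b r)%:C * \sum_i c i * cvf_at r (Z i) f); last first.
  by apply/funext.
have [Kr|/b0->] := pselect (K r); last first.
  by under [X in E r X]funext do rewrite -[0%:C]/(0 : R[i]) mul0r; exact: T10_0.
have [_ ->] := KO r Kr; exists (fun i => (b r)%:C * c i) => f.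
by rewrite mulr_sumr; apply: eq_bigr => i _; rewrite mulrA.
Qed.

Variables (theta : oneform M) (T : VF M) (J : {linear VF M -> VF M}).
Hypothesis hth : is_pseudohermitian E theta.
Hypothesis hT : is_characteristic theta T.
Hypothesis hJ : is_complex_structure E T J.

Lemma thetaD X Y : theta (X + Y) = theta X + theta Y :> Cinf M.
Proof. exact: (linearD (theta : {linear VF M -> (Cinf M)^o})). Qed.
Lemma thetaZ h X : theta (h *: X) = h * theta X :> Cinf M.
Proof. exact: (linearZ_LR (theta : {linear VF M -> (Cinf M)^o})). Qed.
Lemma thetaB X Y : theta (X - Y) = theta X - theta Y :> Cinf M.
Proof. exact: (linearB (theta : {linear VF M -> (Cinf M)^o})). Qed.
Lemma thetaN X : theta (- X) = - theta X :> Cinf M.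
Proof. exact: (linearN (theta : {linear VF M -> (Cinf M)^o})). Qed.
Lemma thetaT : theta T = 1 :> Cinf M. Proof. by case: hT. Qed.

Lemma horizontalP X : horizontal E X <-> theta X = 0 :> Cinf M.
Proof.
split=> [H|H p]; last by apply/hth; rewrite H.
by apply: Cinf_eq => p; apply/hth.
Qed.

(** The frame is T with the real and imaginary parts of a frame of T_{1,0}: 1 + n + n fields.
    Removing the T component of X at q leaves a vector in H(M), the real part of some sum of c_i
    Z_i. *)
Lemma CR_frames q : exists e : 'I_n.*2.+1 -> VF M, forall X, spanned_at q e X.
Proof.
have [Z ZE] := T10_span q.
pose I := option ('I_n + 'I_n)%type.
pose e (i : I) := match i with
  | None => T | Some (inl i) => (Z i).1 | Some (inr i) => (Z i).2 end.
have cI : #|{: I}| = #|'I_n.*2.+1|.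
  by rewrite card_option card_sum !card_ord addnn.
pose b (i : 'I_n.*2.+1) : I := enum_val (cast_ord (esym cI) (enum_rank i)).
have bb : bijective b.
  exists (fun j => enum_val (cast_ord cI (enum_rank j))) => i.
    by rewrite /b enum_valK cast_ordKV enum_rankK.
  by rewrite /b enum_valK cast_ordK enum_rankK.
exists (e \o b) => X.
pose X' := X - scst M (theta X q) *: T.
have : Hbundle E q (vf_at q X').
  by apply/hth; rewrite thetaB thetaZ thetaT !CinfE mulr1 subrr.
move=> /HbundleP[w]; rewrite ZE => -[c cE] wE.
pose a (i : I) := match i with
  | None => (theta X : Cinf M) q
  | Some (inl i) => Re (c i) | Some (inr i) => - Im (c i) end.
exists (a \o b) => f; rewrite [RHS](_ : _ = \sum_i a i * e i f q); last first.
  by rewrite [RHS](reindex b)//=; exact: onW_bij.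
have -> : X f q = vf_at q X' f + theta X q * T f q.
  by rewrite /vf_at /X' !VFE !CinfE subrK.
rewrite wE cE (ReIm_sum (fun i => _)).1.
have -> : \sum_i a i * e i f q = (\sum_i Re (c i) * (Z i).1 f q +
    \sum_i - Im (c i) * (Z i).2 f q) + theta X q * T f q.
  rewrite (bigD1 None)//= addrC; congr (_ + _).
  rewrite (reindex_omap Some id)/=; last by case.
  rewrite (eq_bigl xpredT); last by move=> i; rewrite eqxx.
  by rewrite big_sumType.
congr (_ + _); rewrite -big_split/=; apply: eq_bigr => i _.
by rewrite /cvf_at; case: (c i) => u v /=; rewrite mulNr.
Qed.

Lemma VF_double_inj X Y : X + X = Y + Y -> X = Y.
Proof.
move=> XY; apply: VF_eq => f p.
have := congr1 (fun Z : VF M => Z f p) XY; rewrite !VFE !CinfE => h; lra.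
Qed.

(** For Z = W.1 + i W.2 the defining identity of J reads J (2 W.1) = - 2 W.2, which is then
    halved. *)
Lemma J_section W : is_section E W -> J W.1 = - W.2.
Proof.
move=> SW; have [_ /(_ W SW)] := hJ; rewrite /cof /cmuli /cconj.
move=> /(congr1 fst)/=; rewrite linearD/= opprK => H.
by apply: VF_double_inj; rewrite H opprD.
Qed.

Lemma J_tensorial X p : (forall f, X f p = 0) -> forall f, J X f p = 0.
Proof.
move=> Xp f; apply: (linear_tensorial CR_frames (a := fun X => J X f)) => //.
  by move=> Y Z; rewrite linearD.
by move=> h Y; rewrite linearZ.
Qed.

(** J is prescribed only on real parts of sections of T_{1,0}. At each p the field X agrees with
    such a real part [W.1], and tensoriality of J transfers J W.1 = - W.2 to X at p. *)
Lemma horizontal_section X : horizontal E X -> is_section E (X, - J X).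
Proof.
move=> hX p; have /HbundleP[w Ew wE] := hX p.
have [W SW We] := T10_section Ew.
rewrite (_ : cvf_at p _ = w)//; apply/funext => f; rewrite -We.
have XW : forall h, X h p = W.1 h p by move=> h; have := wE h; rewrite -We.
have : J (X - W.1) f p = 0.
  by apply: J_tensorial => h; rewrite !VFE !CinfE XW subrr.
rewrite linearB (J_section SW) opprK VFD CinfD => e.
have -> : cvf_at p (X, - J X) f = X f p +i* (- J X f p) by [].
rewrite XW; congr (_ +i* _).
by apply/eqP; rewrite eq_sym -subr_eq0 opprK addrC e.
Qed.

(** This is i (X - i J X) = J X + i X. Its real part shows that J X is horizontal, and [J_section]
    applied to it gives J (J X) = - X. *)
Lemma horizontal_section_conj X : horizontal E X -> is_section E (J X, X).
Proof.
move=> hX p; have H := T10_lin ('i) (horizontal_section hX p) (T10_0 p).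
rewrite (_ : cvf_at p _ = fun f => 'i * cvf_at p (X, - J X) f + 0)//.
apply/funext => f.
have -> : cvf_at p (X, - J X) f = X f p +i* (- J X f p) by [].
have -> : cvf_at p (J X, X) f = J X f p +i* X f p by [].
by apply/eqP; rewrite addr0 eq_complex/= !mul0r !mul1r opprK !add0r !eqxx.
Qed.

Lemma J_horizontal X : horizontal E X -> horizontal E (J X).
Proof.
move=> hX p; apply/HbundleP; exists (cvf_at p (J X, X)) => //.
exact: horizontal_section_conj.
Qed.

Lemma JJ X : horizontal E X -> J (J X) = - X.
Proof. by move=> /horizontal_section_conj/J_section. Qed.

End CRFrames.

(** * Connections and metrics *)

Section Brackets.
Variables (R : realType) (d : nat) (M : omanifold R d).
Implicit Types (f g h : Cinf M) (X Y Z : VF M) (p q : M).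

Lemma bracketE X Y f : bracket X Y f = X (Y f) - Y (X f). Proof. by []. Qed.

Lemma bracketC X Y : bracket X Y = - bracket Y X.
Proof. by apply: VF_eq => f p; rewrite !(VFE, bracketE, CinfE); ring. Qed.

Lemma bracketDr X Y Z : bracket X (Y + Z) = bracket X Y + bracket X Z.
Proof. by apply: VF_eq => f p; rewrite !(VFE, bracketE, VF_add, CinfE); ring. Qed.

Lemma bracketNr X Y : bracket X (- Y) = - bracket X Y.
Proof. by apply: VF_eq => f p; rewrite !(VFE, bracketE, VF_N, CinfE); ring. Qed.

Lemma bracketZr h X Y : bracket X (h *: Y) = (X h : Cinf M) *: Y + h *: bracket X Y.
Proof. by apply: VF_eq => f p; rewrite !(VFE, bracketE, VF_mul, CinfE); ring. Qed.

Lemma bracket_jacobi X Y Z :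
  bracket X (bracket Y Z) + bracket Y (bracket Z X) + bracket Z (bracket X Y) = 0.
Proof. by apply: VF_eq => f p; rewrite !(VFE, bracketE, VF_sub, CinfE); ring. Qed.

End Brackets.

(** * Torsion and curvature of a linear connection *)

Section Connections.
Variables (R : realType) (d : nat) (M : omanifold R d) (nabla : VF M -> VF M -> VF M).
Hypothesis conn : is_connection nabla.
Implicit Types (f h : Cinf M) (X Y Z V W : VF M) (p q : M).

Lemma nablaZl h X Y : nabla (h *: X) Y = h *: nabla X Y.
Proof.
have [c _ _] := conn.
have n0 : nabla 0 Y = 0.
  have := c 1 0 0 Y; rewrite scale1r addr0 scale1r => /(congr1 (fun Z => Z - nabla 0 Y)).
  by rewrite subrr addrK.
by rewrite -[h *: X]addr0 c n0 addr0.
Qed.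

Lemma nablaDl X Y Z : nabla (X + Y) Z = nabla X Z + nabla Y Z.
Proof. by have [c _ _] := conn; rewrite -[X in LHS]scale1r c scale1r. Qed.

Lemma nablaDr X Y Z : nabla X (Y + Z) = nabla X Y + nabla X Z.
Proof. by have [_ c _] := conn. Qed.

Lemma nablaZr X h Y : nabla X (h *: Y) = (X h : Cinf M) *: Y + h *: nabla X Y.
Proof. by have [_ _ c] := conn. Qed.

Lemma nablaNl X Y : nabla (- X) Y = - nabla X Y.
Proof. by rewrite -!scaleN1r nablaZl. Qed.

Lemma nablaBl X Y Z : nabla (X - Y) Z = nabla X Z - nabla Y Z.
Proof. by rewrite nablaDl nablaNl. Qed.

Lemma nablaNr X Y : nabla X (- Y) = - nabla X Y.
Proof. by rewrite -!scaleN1r nablaZr VF_N VF_1 oppr0 scale0r add0r. Qed.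

Lemma nablaBr X Y Z : nabla X (Y - Z) = nabla X Y - nabla X Z.
Proof. by rewrite nablaDr nablaNr. Qed.

Lemma torsionC X Y : torsion nabla X Y = - torsion nabla Y X.
Proof.
by apply: VF_eq => f p; rewrite /torsion (bracketC X Y) !VFE !CinfE; ring.
Qed.

Lemma torsionDr X Y Z : torsion nabla X (Y + Z) = torsion nabla X Y + torsion nabla X Z.
Proof.
apply: VF_eq => f p.
by rewrite /torsion nablaDr nablaDl bracketDr !VFE !CinfE; ring.
Qed.

Lemma torsionZr h X Y : torsion nabla X (h *: Y) = h *: torsion nabla X Y.
Proof.
apply: VF_eq => f p.
by rewrite /torsion nablaZr nablaZl bracketZr !VFE !CinfE; ring.
Qed.

Lemma torsionNr X Y : torsion nabla X (- Y) = - torsion nabla X Y.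
Proof. by rewrite -!scaleN1r torsionZr. Qed.

Lemma bracket_torsion X Y : bracket X Y = nabla X Y - nabla Y X - torsion nabla X Y.
Proof. by rewrite /torsion opprB addrCA subrr addr0. Qed.

Lemma curvatureC X Y Z : curvature nabla X Y Z = - curvature nabla Y X Z.
Proof.
by apply: VF_eq => f p; rewrite /curvature (bracketC X Y) nablaNl !VFE !CinfE; ring.
Qed.

Lemma curvatureNr X Y Z : curvature nabla X Y (- Z) = - curvature nabla X Y Z.
Proof. by apply: VF_eq => f p; rewrite /curvature !nablaNr !VFE !CinfE; ring. Qed.

(** A regrouping, since [Y,Z] + Tor(Y,Z) = nabla_Y Z - nabla_Z Y. Each summand on the right equals
    [X,[Y,Z]] + Tor(X,[Y,Z]) + nabla_X Tor(Y,Z), and the double brackets cancel by Jacobi. *)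
Lemma bianchi_bracket X Y Z :
  curvature nabla X Y Z + curvature nabla Y Z X + curvature nabla Z X Y =
  (nabla X (bracket Y Z + torsion nabla Y Z) - nabla (bracket Y Z) X) +
  (nabla Y (bracket Z X + torsion nabla Z X) - nabla (bracket Z X) Y) +
  (nabla Z (bracket X Y + torsion nabla X Y) - nabla (bracket X Y) Z).
Proof.
rewrite /curvature /torsion ![bracket _ _ + _]addrC !subrK !nablaBr.
by apply: VF_eq => f p; rewrite !VFE !CinfE; ring.
Qed.

End Connections.

(** * Riemannian metrics on the module of vector fields *)

Section Riemannian.
Variables (R : realType) (d : nat) (M : omanifold R d) (g : VF M -> VF M -> Cinf M).
Hypothesis riem : is_riemannian g.
Implicit Types (f h : Cinf M) (X Y Z V W : VF M) (p q : M).

Lemma metricC X Y : g X Y = g Y X. Proof. by have [] := riem. Qed.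

Lemma metricDl X Y Z : g (X + Y) Z = g X Z + g Y Z.
Proof. by have [c _ _] := riem; rewrite -[X in LHS]scale1r c mul1r. Qed.

Lemma metricZl h X Y : g (h *: X) Y = h * g X Y.
Proof.
have [c _ _] := riem.
have g0 : g 0 Y = 0.
  have := metricDl 0 0 Y; rewrite addr0 => /(congr1 (fun h => h - g 0 Y)).
  by rewrite subrr addrK.
by rewrite -[h *: X]addr0 c g0 addr0.
Qed.

Lemma metricNl X Y : g (- X) Y = - g X Y.
Proof. by rewrite -scaleN1r metricZl mulN1r. Qed.
Lemma metricBl X Y Z : g (X - Y) Z = g X Z - g Y Z.
Proof. by rewrite metricDl metricNl. Qed.
Lemma metricDr X Y Z : g X (Y + Z) = g X Y + g X Z.
Proof. by rewrite metricC metricDl !(metricC X). Qed.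
Lemma metricZr h X Y : g X (h *: Y) = h * g X Y.
Proof. by rewrite metricC metricZl (metricC X). Qed.
Lemma metricNr X Y : g X (- Y) = - g X Y.
Proof. by rewrite metricC metricNl (metricC X). Qed.
Lemma metricBr X Y Z : g X (Y - Z) = g X Y - g X Z.
Proof. by rewrite metricDr metricNr. Qed.
Lemma metric0l X : g 0 X = 0.
Proof. by rewrite -(scale0r (0 : VF M)) metricZl mul0r. Qed.
Lemma metric_suml (I : Type) (r : seq I) (P : pred I) (F : I -> VF M) X :
  g (\sum_(i <- r | P i) F i) X = \sum_(i <- r | P i) g (F i) X.
Proof. by elim/big_rec2: _ => [|i y1 y2 _ <-]; rewrite ?metric0l ?metricDl. Qed.

Lemma metric_linear Y : linear (fun X => g X Y : (Cinf M)^o).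
Proof. by move=> h X Z; rewrite metricDl metricZl. Qed.

(** Orthonormal frames get from it the dual coframes required by [is_trace]. *)
Definition metric_form Y : oneform M :=
  HB.pack (fun X => g X Y : (Cinf M)^o)
    (GRing.isLinear.Build _ _ _ _ (fun X => g X Y : (Cinf M)^o) (metric_linear Y)).

Lemma metric_formE Y X : metric_form Y X = g X Y :> Cinf M. Proof. by []. Qed.

Lemma metric_definite X : g X X = 0 -> X = 0.
Proof.
move=> X0; apply: VF_eq => f p.
have [E|E] := pselect (vf_at p X = 0); first by have := congr1 (fun F => F f) E.
by have [_ _ /(_ X p E)] := riem; rewrite X0 Cinf0 ltxx.
Qed.

Hypothesis frames : forall q, exists e : 'I_d -> VF M, forall X, spanned_at q e X.

Lemma metric_tensorial X Y p : (forall f, X f p = 0) -> g X Y p = 0.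
Proof.
move=> X0; apply: (linear_tensorial frames (a := fun X => g X Y)) => //.
  by move=> *; exact: metricDl.
by move=> *; exact: metricZl.
Qed.

Lemma metric_gt0 X p : ~ (forall f, X f p = 0) -> 0 < g X X p.
Proof.
move=> X0; have [_ _] := riem; apply => E; apply: X0 => f.
exact: (congr1 (fun F => F f) E).
Qed.

Lemma metric_ge0 X p : 0 <= g X X p.
Proof.
have [X0|X0] := pselect (forall f, X f p = 0); first by rewrite metric_tensorial.
exact/ltW/metric_gt0.
Qed.

End Riemannian.

(** * The Webster metric *)

Section Webster.
Variables (R : realType) (n : nat) (M : omanifold R n.*2.+1) (E : CR_structure M n).
Variables (theta : oneform M) (T : VF M) (J : {linear VF M -> VF M}).
Variable g : VF M -> VF M -> Cinf M.
Hypothesis hth : is_pseudohermitian E theta.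
Hypothesis hT : is_characteristic theta T.
Hypothesis hJ : is_complex_structure E T J.
Hypothesis hg : is_webster_metric E theta J T g.
Implicit Types (f h : Cinf M) (X Y Z V W : VF M) (p q : M).
Local Notation hz := (horizontal E).

Let riem : is_riemannian g. Proof. by case: hg. Qed.
Let frames := CR_frames hth hT.
Let thetaDE := thetaD theta.
Let thetaZE := thetaZ theta.
Let thetaBE := thetaB theta.
Let theta_T : theta T = 1 :> Cinf M := thetaT hT.

Lemma horizontal0 : hz 0.
Proof. by apply/(horizontalP hth); rewrite -(subrr T) thetaBE subrr. Qed.

Lemma horizontalD X Y : hz X -> hz Y -> hz (X + Y).
Proof.
move=> /(horizontalP hth) X0 /(horizontalP hth) Y0; apply/(horizontalP hth).
by rewrite thetaDE X0 Y0 addr0.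
Qed.

Lemma horizontalZ h X : hz X -> hz (h *: X).
Proof.
move=> /(horizontalP hth) X0; apply/(horizontalP hth).
by rewrite thetaZE X0 mulr0.
Qed.

Lemma horizontalB X Y : hz X -> hz Y -> hz (X - Y).
Proof.
by move=> hX hY; rewrite -scaleN1r; apply: horizontalD => //; exact: horizontalZ.
Qed.

Lemma horizontal_sum (I : Type) (r : seq I) (F : I -> VF M) :
  (forall i, hz (F i)) -> hz (\sum_(i <- r) F i).
Proof.
move=> hF; elim/big_rec: _ => [|i X _ hX]; first exact: horizontal0.
exact: horizontalD.
Qed.

Lemma horizontal_pi X : hz (pi_H theta T X).
Proof.
by apply/(horizontalP hth); rewrite /pi_H thetaBE thetaZE theta_T mulr1 subrr.
Qed.

Lemma pi_decomp X : X = pi_H theta T X + (theta X : Cinf M) *: T.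
Proof. by rewrite /pi_H subrK. Qed.

Lemma webster_T X : g X T = theta X.
Proof.
have [_ _ gT0 gTT] := hg; rewrite [X in LHS]pi_decomp (metricDl riem) (metricZl riem).
by rewrite gT0 ?gTT ?mulr1 ?add0r//; exact: horizontal_pi.
Qed.

Lemma webster_hT X : hz X -> g X T = 0. Proof. by case: hg => _ _ + _; exact. Qed.
Lemma webster_Th X : hz X -> g T X = 0. Proof. by rewrite (metricC riem); exact: webster_hT. Qed.

Lemma half2 : scst M 2^-1 * 2 = 1.
Proof. by apply: Cinf_eq => p; rewrite -[X in _ * X]/(1 + 1 : Cinf M) !CinfE; field. Qed.

Lemma ext_d_theta X Y : hz X -> hz Y ->
  theta (bracket X Y) = - (2 * ext_d theta X Y) :> Cinf M.
Proof.
move=> /(horizontalP hth) X0 /(horizontalP hth) Y0.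
by rewrite /ext_d X0 Y0 !VF_0 subrr sub0r mulrA [2 * _]mulrC half2 mul1r opprK.
Qed.

Lemma ext_dC X Y : ext_d theta X Y = - ext_d theta Y X.
Proof.
rewrite /ext_d (bracketC X Y) -mulrN; congr (_ * _).
have -> : theta (- bracket Y X) = - theta (bracket Y X) :> Cinf M.
  by rewrite -scaleN1r thetaZE mulN1r.
ring.
Qed.

Lemma webster_levi X Y : hz X -> hz Y -> g X Y = ext_d theta X (J Y).
Proof. by case: hg => _ + _ _; exact. Qed.

Let hzJ X : hz X -> hz (J X) := @J_horizontal _ _ _ _ _ _ _ hth hT hJ X.
Let JJE X : hz X -> J (J X) = - X := @JJ _ _ _ _ _ _ _ hth hT hJ X.

Lemma ext_dNr X Y : ext_d theta X (- Y) = - ext_d theta X Y.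
Proof.
rewrite /ext_d bracketNr !(thetaN theta) VF_N VFN -mulrN; congr (_ * _); ring.
Qed.

Lemma webster_J_ext_d X Y : hz X -> hz Y -> g (J X) Y = ext_d theta X Y.
Proof.
move=> hX hY; rewrite (metricC riem) webster_levi//; last exact: hzJ.
by rewrite JJE// ext_dNr ext_dC opprK.
Qed.

Lemma webster_Jl X Y : hz X -> hz Y -> g (J X) Y = - g X (J Y).
Proof.
move=> hX hY; rewrite webster_J_ext_d// webster_levi//; last exact: hzJ.
by rewrite JJE// ext_dNr opprK.
Qed.

Lemma webster_JJ X Y : hz X -> hz Y -> g (J X) (J Y) = g X Y.
Proof.
by move=> hX hY; rewrite webster_Jl//; [rewrite JJE// (metricNr riem) opprK|exact: hzJ].
Qed.

Lemma theta_bracket X Y : hz X -> hz Y ->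
  theta (bracket X Y) = - (2 * g (J X) Y) :> Cinf M.
Proof.
by move=> hX hY; rewrite ext_d_theta// webster_J_ext_d.
Qed.

Lemma theta_bracketT X : hz X -> theta (bracket T X) = 0 :> Cinf M.
Proof.
move=> hX; have [_ /(_ X)] := hT; rewrite /ext_d theta_T VF_1 subr0.
move: (hX) => /(horizontalP hth) ->; rewrite VF_0 sub0r => /(congr1 (fun h => 2 * h)).
by rewrite mulrA [2 * _]mulrC half2 mul1r mulr0 => /(congr1 -%R); rewrite opprK oppr0.
Qed.


Definition orthonormal_at p m (e : 'I_m -> VF M) :=
  (forall i, hz (e i)) /\ forall i j, g (e i) (e j) p = (i == j)%:R.

Definition with_T m (e : 'I_m -> VF M) (i : 'I_m.+1) : VF M :=
  oapp e T (unlift ord0 i).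

Lemma with_T0 m (e : 'I_m -> VF M) : with_T e ord0 = T.
Proof. by rewrite /with_T unlift_none. Qed.

Lemma with_TS m (e : 'I_m -> VF M) i : with_T e (lift ord0 i) = e i.
Proof. by rewrite /with_T liftK. Qed.

Lemma with_T_orthonormal p m (e : 'I_m -> VF M) : orthonormal_at p e ->
  forall i j, g (with_T e i) (with_T e j) p = (i == j)%:R.
Proof.
have [_ _ _ gTT] := hg.
move=> [he one] i j; case: (unliftP ord0 i) => [i'|] ->;
  case: (unliftP ord0 j) => [j'|] ->; rewrite ?with_T0 ?with_TS.
- by rewrite one (inj_eq (@lift_inj _ ord0)).
- by rewrite webster_hT// eq_sym (negPf (neq_lift _ _)).
- by rewrite webster_Th// (negPf (neq_lift _ _)).
- by rewrite gTT eqxx.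
Qed.

Lemma comb_at (I : finType) (a : I -> R) (e : I -> VF M) f p :
  (\sum_i scst M (a i) *: e i) f p = \sum_i a i * e i f p.
Proof. by rewrite VFsum Cinf_sum; apply: eq_bigr. Qed.

Lemma metric_comb (I : finType) (a : I -> R) (e : I -> VF M) X p :
  g (\sum_i scst M (a i) *: e i) X p = \sum_i a i * g (e i) X p.
Proof. by rewrite (metric_suml riem) Cinf_sum; apply: eq_bigr => i _; rewrite (metricZl riem). Qed.

Lemma frame_coef p m (e : 'I_m -> VF M) (a : 'I_m -> R) X :
  (forall i j, g (e i) (e j) p = (i == j)%:R) ->
  (forall f, X f p = \sum_i a i * e i f p) -> forall j, g X (e j) p = a j.
Proof.
move=> one Xe j; have : g (X - \sum_i scst M (a i) *: e i) (e j) p = 0.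
  by apply: (metric_tensorial riem frames) => f; rewrite VFB CinfB comb_at Xe subrr.
rewrite (metricBl riem) CinfB metric_comb (bigD1 j)//= one eqxx mulr1 big1 ?addr0.
  by move=> /eqP; rewrite subr_eq0 => /eqP.
by move=> i ij; rewrite one (negPf ij) mulr0.
Qed.

Lemma orthonormal_expand p (e : 'I_n.*2 -> VF M) X : orthonormal_at p e -> hz X ->
  forall f, X f p = \sum_i g X (e i) p * e i f p.
Proof.
move=> one hX; have onT := with_T_orthonormal one.
have [|a aX] := @spanned_of_free _ _ _ frames p (with_T e) _ X.
  move=> a a0 j; have := @frame_coef p _ _ a 0 onT _ j.
  by rewrite (metric0l riem) => <-// f; rewrite a0.
have aE := frame_coef onT aX.
move=> f; rewrite aX big_ord_recl with_T0 -aE with_T0 webster_hT// mul0r add0r.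
by apply: eq_bigr => i _; rewrite -aE with_TS.
Qed.

Lemma orthonormal_tensorial p (e : 'I_n.*2 -> VF M) (a : VF M -> Cinf M) X :
  (forall X Y, a (X + Y) = a X + a Y) -> (forall h X, a (h *: X) = h * a X) ->
  orthonormal_at p e -> hz X -> a X p = \sum_i g X (e i) p * a (e i) p.
Proof.
move=> aD aZ one hX.
have a0 : a 0 = 0 by rewrite -(scale0r (0 : VF M)) aZ mul0r.
have : a (X - \sum_i scst M (g X (e i) p) *: e i) p = 0.
  apply: (linear_tensorial frames) => // f.
  by rewrite VFB CinfB comb_at (orthonormal_expand one hX) subrr.
rewrite aD -scaleN1r aZ (big_morph a aD a0) mulN1r CinfD CinfN Cinf_sum.
move=> /eqP; rewrite subr_eq0 => /eqP ->; apply: eq_bigr => i _.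
by rewrite aZ.
Qed.

Lemma parseval p (e : 'I_n.*2 -> VF M) X Y : orthonormal_at p e -> hz X ->
  g X Y p = \sum_i g X (e i) p * g (e i) Y p.
Proof.
move=> one hX; apply: (orthonormal_tensorial (a := fun X => g X Y)) => //.
  by move=> *; exact: (metricDl riem).
by move=> *; exact: (metricZl riem).
Qed.

Lemma trace_orthonormal (L : VF M -> VF M) h p (e : 'I_n.*2 -> VF M) :
  is_trace L h -> orthonormal_at p e ->
  h p = g (L T) T p + \sum_i g (L (e i)) (e i) p.
Proof.
move=> tr one.
rewrite (tr p (with_T e) (fun i => metric_form riem (with_T e i))).
  by rewrite big_ord_recl with_T0; congr (_ + _); apply: eq_bigr => i _; rewrite with_TS.
move=> i j; rewrite metric_formE (metricC riem); exact: with_T_orthonormal.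
Qed.

(** Gram-Schmidt with global horizontal fields. T and the m fields already found are m + 1 < 2n + 1
    in number, so some Y is independent of them at p; its horizontal part minus projections is
    nonzero at p and is normalized near p. *)
Lemma orthonormal_exists_aux p m : (m <= n.*2)%N -> exists e : 'I_m -> VF M,
  (forall i, hz (e i)) /\
  forall i j, \forall q \near p, g (e i) (e j) q = (i == j)%:R.
Proof.
elim: m => [_|m IH lt]; first by exists (fun=> 0); split=> -[].
have [e [he one]] := IH (ltnW lt).
have [Y nY] := @not_spanned _ _ _ p m.+1 (with_T e) lt.
pose X := pi_H theta T Y - \sum_i g Y (e i) *: e i.
have hX : hz X.
  apply: horizontalB; first exact: horizontal_pi.
  by apply: horizontal_sum => i; exact: horizontalZ.
have Xe j : \forall q \near p, g X (e j) q = 0.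
  have nj : \forall q \near p, forall i, g (e i) (e j) q = (i == j)%:R.
    by apply: (@filter_forall _ _ _ (nbhs p) (nbhs_filter p)) => i; exact: one.
  apply: filterS nj => q onj; rewrite (metricBl riem) CinfB (metric_suml riem) Cinf_sum.
  under eq_bigr do rewrite (metricZl riem) CinfM onj.
  rewrite (bigD1 j)//= eqxx mulr1 big1 ?addr0; last first.
    by move=> i /negPf->; rewrite mulr0.
  by rewrite /pi_H (metricBl riem) (metricZl riem) (webster_Th (he j)) mulr0 subr0 subrr.
have X0 : 0 < g X X p.
  apply: (metric_gt0 riem) => X0; apply: nY.
  exists (fun i => oapp (fun i => g Y (e i) p) (theta Y p) (unlift ord0 i)) => f.
  rewrite big_ord_recl unlift_none with_T0 /=.
  under eq_bigr do rewrite liftK with_TS /=.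
  have := X0 f; rewrite /X /pi_H !VFE !CinfE Cinf_sum => /eqP.
  rewrite subr_eq0 => /eqP => h; rewrite -[LHS](subrK (theta Y p * T f p)).
  rewrite h addrC; congr (_ + _); exact: eq_bigr.
have [s sP] := local_isqrt X0.
pose e' (i : 'I_m.+1) := oapp e (s *: X) (unlift ord0 i).
exists e'; split=> [i|i j]; rewrite /e'.
  by case: (unliftP ord0 i) => [i'|] _ /=; [exact: he|exact: horizontalZ].
case: (unliftP ord0 i) => [i'|] ->; case: (unliftP ord0 j) => [j'|] -> /=.
- by rewrite (inj_eq (@lift_inj _ ord0)).
- apply: filterS (Xe i') => q; rewrite (metricZr riem) (metricC riem) CinfM => ->.
  by rewrite mulr0.
- apply: filterS (Xe j') => q; rewrite (metricZl riem) CinfM => ->.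
  by rewrite mulr0.
- by apply: filterS sP => q; rewrite (metricZl riem) (metricZr riem) mulrA.
Qed.

Lemma orthonormal_exists p : exists e : 'I_n.*2 -> VF M,
  \forall q \near p, orthonormal_at q e.
Proof.
have [e [he one]] := @orthonormal_exists_aux p _ (leqnn _).
exists e; have : \forall q \near p, forall ij : 'I_n.*2 * 'I_n.*2,
    g (e ij.1) (e ij.2) q = (ij.1 == ij.2)%:R.
  by apply: (@filter_forall _ _ _ (nbhs p) (nbhs_filter p)) => ij; exact: one.
by apply: filterS => q H; split=> // i j; exact: H (i, j).
Qed.

Lemma orthonormal_J p (e : 'I_n.*2 -> VF M) :
  orthonormal_at p e -> orthonormal_at p (fun i => J (e i)).
Proof.
by move=> [he one]; split=> [i|i j]; [exact: hzJ|rewrite webster_JJ].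
Qed.

End Webster.

(** * The Tanaka-Webster connection *)

Section TanakaWebster.
Variables (R : realType) (n : nat) (M : omanifold R n.*2.+1) (E : CR_structure M n).
Variables (theta : oneform M) (T : VF M) (J : {linear VF M -> VF M}).
Variables (g : VF M -> VF M -> Cinf M) (nabla : VF M -> VF M -> VF M).
Hypothesis hth : is_pseudohermitian E theta.
Hypothesis hT : is_characteristic theta T.
Hypothesis hJ : is_complex_structure E T J.
Hypothesis hg : is_webster_metric E theta J T g.
Hypothesis hN : is_tanaka_webster E theta J T g nabla.
Implicit Types (f h : Cinf M) (X Y Z V W : VF M) (p q : M).
Local Notation hz := (horizontal E).
Local Notation tauT := (tau nabla T).
Local Notation curv := (curvature nabla).
Local Notation A := (ps_torsion g nabla T).

Let riem : is_riemannian g. Proof. by case: hg. Qed.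
Let conn : is_connection nabla. Proof. by case: hN. Qed.
Let theta_T : theta T = 1 :> Cinf M := thetaT hT.
Let hzJ X : hz X -> hz (J X) := @J_horizontal _ _ _ _ _ _ _ hth hT hJ X.
Let JJE X : hz X -> J (J X) = - X := @JJ _ _ _ _ _ _ _ hth hT hJ X.
Let gTh X : hz X -> g T X = 0 := @webster_Th _ _ _ _ _ _ _ _ hg X.

Lemma nabla_horizontal X Y : hz Y -> hz (nabla X Y).
Proof. by have [_ [+ _]] := hN; exact. Qed.

Lemma nabla_metric X Y Z : X (g Y Z) = g (nabla X Y) Z + g Y (nabla X Z) :> Cinf M.
Proof. by have [_ [_ [+ _]]] := hN; exact. Qed.

Lemma nablaJ X Y : nabla X (J Y) = J (nabla X Y).
Proof. by have [_ [_ [_ [+ _]]]] := hN; exact. Qed.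

Lemma Cinf_double0 h : h + h = 0 -> h = 0.
Proof.
move=> hh; apply: Cinf_eq => p; have := congr1 (fun h : Cinf M => h p) hh.
by rewrite !CinfE => ?; lra.
Qed.

(** As |T| = 1, nabla_X T is orthogonal to T, hence horizontal. Differentiating g(T, W) = 0 with W =
    nabla_X T gives |W|^2 = 0, because nabla_X W is horizontal. *)
Lemma nablaT X : nabla X T = 0.
Proof.
have hW : hz (nabla X T).
  apply/(horizontalP hth); rewrite -(webster_T hth hT hg).
  apply: Cinf_double0; rewrite {2}(metricC riem) -nabla_metric.
  by have [_ _ _ ->] := hg; exact: VF_1.
apply: (metric_definite riem).
have := nabla_metric X T (nabla X T).
rewrite gTh// VF_0 (gTh (nabla_horizontal X hW)) addr0; exact: esym.
Qed.

(** The torsion axioms at X - i J X and Y - i J Y have real parts Tor(X,Y) - Tor(JX,JY) = 0 and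
    Tor(X,Y) + Tor(JX,JY) = s T. So Tor(X,Y) is a multiple of T, and its coefficient is read off
    from theta(Tor(X,Y)) = - theta([X,Y]). *)
Lemma torsion_horizontal X Y : hz X -> hz Y ->
  torsion nabla X Y = (2 * g (J X) Y) *: T.
Proof.
move=> hX hY.
have [_ [_ [_ [_ [tors _]]]]] := hN.
have sX := horizontal_section hth hT hJ hX.
have sY := horizontal_section hth hT hJ hY.
have [e1' e2'] := tors _ _ sX sY.
have e1 : torsion nabla X Y - torsion nabla (- J X) (- J Y) = 0 := congr1 fst e1'.
pose s := (cmuli (cbilin (levi theta J) (X, - J X) (cconj (Y, - J Y))) *+ 2).1.
have e2 : torsion nabla X Y - torsion nabla (- J X) (- - J Y) = s *: T :=
  congr1 fst e2'.
rewrite (torsionNr conn (- J X) (- J Y)) opprK -(subr0_eq e1) in e2.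
have e3 : torsion nabla X Y = (scst M 2^-1 * s) *: T.
  have half1 : 2^-1 + 2^-1 = 1 :> R by field.
  by apply: VF_double_inj; rewrite e2 -scalerDl -mulrDl -scstD half1 scst1 mul1r.
suff <- : theta (torsion nabla X Y) = 2 * g (J X) Y :> Cinf M.
  by rewrite e3 (thetaZ theta) theta_T mulr1.
have t0 Z W : hz W -> theta (nabla Z W) = 0 :> Cinf M.
  by move=> hW; apply/(horizontalP hth); exact: nabla_horizontal.
rewrite /torsion !(thetaB theta) (t0 X Y)// (t0 Y X)//.
by rewrite (theta_bracket hth hT hJ hg)// subrr sub0r opprK.
Qed.

Lemma tauE X : tauT X = nabla T X - bracket T X.
Proof. by rewrite /tau /torsion nablaT subr0. Qed.

Lemma tau_horizontal X : hz X -> hz (tauT X).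
Proof.
move=> hX; rewrite tauE; apply: (horizontalB hth).
  exact: nabla_horizontal.
by apply/(horizontalP hth); rewrite (theta_bracketT hth hT).
Qed.

Lemma tauJ X : tauT (J X) = - J (tauT X).
Proof.
have [_ [_ [_ [_ [_ tJ]]]]] := hN; apply/eqP; rewrite -addr_eq0; apply/eqP; exact: tJ.
Qed.

Lemma ps_torsionJ X Y : hz X -> hz Y ->
  ps_torsion g nabla T (J X) Y = ps_torsion g nabla T X (J Y).
Proof.
move=> hX hY; rewrite /ps_torsion tauJ (metricNl riem) (webster_Jl hth hT hJ hg) ?opprK//.
exact: tau_horizontal.
Qed.

Lemma torsion_any X V W : hz X -> hz W ->
  g (torsion nabla X V) W = - (theta V * ps_torsion g nabla T X W).
Proof.
move=> hX hW; rewrite [V in LHS](pi_decomp theta T) (torsionDr conn) (torsionZr conn).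
rewrite torsion_horizontal//; last exact: (horizontal_pi hth hT).
rewrite (metricDl riem) !(metricZl riem) gTh// mulr0 add0r (torsionC _ X T) (metricNl riem) mulrN.
by [].
Qed.

(** As T is parallel, the derivative of Tor(Y,Z) is a multiple of T and is orthogonal to W. In
    Tor(X,[Y,Z]) only the T component of the bracket, theta([Y,Z]) = - 2 g(JY,Z), pairs with W. *)
Lemma bianchi_term X Y Z W : hz X -> hz Y -> hz Z -> hz W ->
  g (nabla X (bracket Y Z + torsion nabla Y Z) - nabla (bracket Y Z) X) W =
  2 * g (J Y) Z * ps_torsion g nabla T X W + g (bracket X (bracket Y Z)) W.
Proof.
move=> hX hY hZ hW; rewrite (nablaDr conn) torsion_horizontal// (nablaZr conn).
rewrite nablaT scaler0 addr0 (metricBl riem) (metricDl riem) (metricZl riem) gTh// mulr0 addr0.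
rewrite -(metricBl riem).
have := torsion_any (bracket Y Z) hX hW.
rewrite /torsion (metricBl riem) (theta_bracket hth hT hJ hg)// mulNr opprK.
by move=> /(canRL (subrK _)).
Qed.

Lemma bianchi X Y Z W : hz X -> hz Y -> hz Z -> hz W ->
  g (curv X Y Z) W + g (curv Y Z X) W + g (curv Z X Y) W =
  2 * (g (J Y) Z * ps_torsion g nabla T X W + g (J Z) X * ps_torsion g nabla T Y W
       + g (J X) Y * ps_torsion g nabla T Z W).
Proof.
move=> hX hY hZ hW.
have gD3 U1 U2 U3 : g (U1 + U2 + U3) W = g U1 W + g U2 W + g U3 W.
  by rewrite !(metricDl riem).
rewrite -gD3 (bianchi_bracket conn) gD3 !bianchi_term//.
have := congr1 (fun V => g V W) (bracket_jacobi X Y Z).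
rewrite /= gD3 (metric0l riem) => jac.
by rewrite -[RHS]addr0 -jac; ring.
Qed.

Lemma curvature_skew X Y Z W : g (curv X Y Z) W = - g Z (curv X Y W).
Proof.
have H := nabla_metric (bracket X Y) Z W.
rewrite bracketE [Y (g Z W)]nabla_metric [X (g Z W)]nabla_metric in H.
rewrite !VF_add !nabla_metric in H.
apply: Cinf_eq => p; have := congr1 (fun h : Cinf M => h p) H.
rewrite /curvature !(metricBl riem) !(metricBr riem) !CinfE => h; lra.
Qed.

Lemma curvature_horizontal X Y Z : hz Z -> hz (curv X Y Z).
Proof.
move=> hZ; do 2?[apply: (horizontalB hth)]; by repeat apply: nabla_horizontal.
Qed.

Lemma curvatureJ X Y Z : curv X Y (J Z) = J (curv X Y Z).
Proof. by rewrite /curvature !nablaJ !linearB. Qed.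

Variable rho : VF M -> VF M -> Cinf M.
Hypothesis ric : is_ricci nabla rho.

Lemma ricci_orthonormal p (e : 'I_n.*2 -> VF M) X :
  orthonormal_at E g p e -> hz X ->
  rho X X p = \sum_i g (curv (e i) X X) (e i) p.
Proof.
move=> one hX; rewrite (trace_orthonormal hg (ric X X) one).
rewrite (metricC riem) gTh ?add0r//; exact: curvature_horizontal.
Qed.

Lemma ricci_J X p : hz X ->
  rho X X p - rho (J X) (J X) p = 4 * (n%:R - 1) * ps_torsion g nabla T X (J X) p.
Proof.
move=> hX; have hJX := hzJ hX.
pose Q V Y := g (curv V Y Y) V.
have gJs V W : hz V -> hz W -> g (J V) W = - g V (J W).
  by move=> hV hW; rewrite (webster_Jl hth hT hJ hg).
have k1 V : hz V -> g (curv V (J X) (J V)) X = Q V (J X).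
  move=> hV; rewrite curvatureJ gJs//; last exact: curvature_horizontal.
  by rewrite curvature_skew opprK (metricC riem).
have m1 V : hz V -> g (curv V X (J V)) (J X) = - Q V X.
  move=> hV; rewrite curvatureJ (webster_JJ hth hT hJ hg)//; last exact: curvature_horizontal.
  by rewrite curvature_skew (metricC riem).
have flip V Y : hz V -> curv Y (J V) V = curv (J V) Y (J (J V)).
  by move=> hV; rewrite JJE// (curvatureNr conn) (curvatureC conn).
have psJ V W : hz V -> hz W -> A (J V) W = A V (J W) by exact: ps_torsionJ.
(* The torsion terms left when the Bianchi identities for (V, JX, JV) against X and for (V, X, JV)
   against JX are added. *)
pose r V := g (J X) V * A V X - g V V * A X (J X) + g X V * A V (J X).
(* The first two curvature terms of each identity become values of Q, as R commutes with J. The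
   third terms, involving R(JV, V), are opposite by skew-symmetry and cancel in the sum. *)
have key V : hz V -> Q V (J X) + Q (J V) (J X) - (Q V X + Q (J V) X) = 4 * r V.
  move=> hV; have hJV := hzJ hV.
  have b1 := bianchi hV hJX hJV hX; have b2 := bianchi hV hX hJV hJX.
  rewrite k1// flip// k1// JJE// in b1; rewrite m1// flip// m1// in b2.
  rewrite curvature_skew (metricC riem X) in b2.
  rewrite !JJE// !(metricNl riem) -gJs// (webster_JJ hth hT hJ hg)// !psJ// in b1.
  rewrite !JJE// !(metricNl riem) (webster_JJ hth hT hJ hg)// gJs// !psJ// JJE// in b2.
  apply: Cinf_eq => q; have := congr1 (fun h : Cinf M => h q) b1.
  have := congr1 (fun h : Cinf M => h q) b2.
  rewrite /r /ps_torsion !(metricNr riem) (metricC riem V X) (metricC riem V (J X)) !CinfE.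
  by move=> h1 h2; lra.
have [e /nbhs_singleton one] := orthonormal_exists hth hT hg p.
have [he ge] := one.
(* Both [e] and [J e] compute the Ricci trace, so summing [key] yields twice the difference of rho
   at JX and at X. *)
have oneJ := orthonormal_J hth hT hJ hg one.
have rE Y : hz Y -> rho Y Y p = \sum_i Q (e i) Y p by exact: ricci_orthonormal.
have rJE Y : hz Y -> rho Y Y p = \sum_i Q (J (e i)) Y p by exact: ricci_orthonormal.
have sumr : \sum_i r (e i) p = (2 - n.*2%:R) * A X (J X) p.
  have AD W V Y : A (V + Y) W = A V W + A Y W.
    by rewrite /ps_torsion /tau (torsionDr conn) (metricDl riem).
  have AZ W h V : A (h *: V) W = h * A V W.
    by rewrite /ps_torsion /tau (torsionZr conn) (metricZl riem).
  have a1 := orthonormal_tensorial hth hT hg (AD X) (AZ X) one hJX.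
  have a2 := orthonormal_tensorial hth hT hg (AD (J X)) (AZ (J X)) one hX.
  rewrite psJ// in a1.
  under eq_bigr do rewrite /r CinfD CinfB !CinfM ge eqxx mul1r.
  rewrite big_split/= sumrB -a1 -a2 sumr_const card_ord -mulr_natl.
  by ring.
have keyp : \sum_i (Q (e i) (J X) + Q (J (e i)) (J X) -
    (Q (e i) X + Q (J (e i)) X)) p = 4 * \sum_i r (e i) p.
  rewrite mulr_sumr; apply: eq_bigr => i _; by rewrite key.
have := keyp; rewrite sumr; under eq_bigr do rewrite CinfB !CinfD.
have n2 : n.*2%:R = 2 * n%:R :> R by rewrite -mul2n natrM.
rewrite sumrB !big_split/= -!rE// -!rJE// n2 => h.
by lra.
Qed.

End TanakaWebster.

(** * The Bochner formula *)

Section Bochner.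
Variables (R : realType) (n : nat) (M : omanifold R n.*2.+1) (E : CR_structure M n).
Variables (theta : oneform M) (T : VF M) (J : {linear VF M -> VF M}).
Variables (g : VF M -> VF M -> Cinf M) (nabla : VF M -> VF M -> VF M).
Variables (rho : VF M -> VF M -> Cinf M) (grad : Cinf M -> VF M) (div : VF M -> Cinf M).
Hypothesis hth : is_pseudohermitian E theta.
Hypothesis hT : is_characteristic theta T.
Hypothesis hJ : is_complex_structure E T J.
Hypothesis hg : is_webster_metric E theta J T g.
Hypothesis hN : is_tanaka_webster E theta J T g nabla.
Hypothesis ric : is_ricci nabla rho.
Hypothesis hgrad : is_gradient g grad.
Hypothesis hdiv : is_divergence g div.
Implicit Types (h : Cinf M) (X Y Z V W : VF M) (p q : M).
Local Notation hz := (horizontal E).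
Local Notation A := (ps_torsion g nabla T).

Let riem : is_riemannian g. Proof. by case: hg. Qed.
Let conn : is_connection nabla. Proof. by case: hN. Qed.
Let hzJ X : hz X -> hz (J X) := @J_horizontal _ _ _ _ _ _ _ hth hT hJ X.
Let gTh X : hz X -> g T X = 0 := @webster_Th _ _ _ _ _ _ _ _ hg X.
Let metric := nabla_metric hN.
Let nabla_hz := nabla_horizontal hN.

(** The divergence is a Levi-Civita trace. For a unit field e, g(D_e V, e) and g(nabla_e V, e)
    differ by g(D_V e, e) - g(nabla_V e, e) = 0, both being V(|e|^2)/2, and by a torsion term along
    T. The T entry of the trace vanishes since theta([T,V]) = 0. *)
Lemma div_orthonormal p (e : 'I_n.*2 -> VF M) V : orthonormal_at E g p e -> hz V ->
  div V p = \sum_i g (nabla (e i) V) (e i) p.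
Proof.
move=> one hV; have [he _] := one; have [D [_ Dtor Dmet] tr] := hdiv.
rewrite (trace_orthonormal hg (tr V) one).
have DE X : D X V = D V X + bracket X V.
  by have := Dtor X V; rewrite /torsion => /subr0_eq/(canRL (subrK _)); rewrite addrC.
have -> : g (D T V) T = 0.
  rewrite DE (metricDl riem) [g (bracket T V) T](webster_T hth hT hg) (theta_bracketT hth hT)// addr0.
  apply: Cinf_double0; rewrite {2}(metricC riem) -Dmet.
  by have [_ _ _ ->] := hg; exact: VF_1.
rewrite add0r; apply: eq_bigr => i _; congr (cinf_fun _ p).
have -> : nabla (e i) V = nabla V (e i) + bracket (e i) V + torsion nabla (e i) V.
  by rewrite /torsion; apply: VF_eq => f q; rewrite !VFE !CinfE; ring.
rewrite DE (torsion_horizontal hth hT hJ hg hN)// !(metricDl riem) (metricZl riem) gTh// mulr0 addr0.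
congr (_ + _); apply/eqP; rewrite -subr_eq0; apply/eqP; apply: Cinf_double0.
have := metric V (e i) (e i); rewrite Dmet !(metricC riem (e i)) => H.
by rewrite addrACA H -opprD subrr.
Qed.

Lemma metric_pi_grad h Y : hz Y -> g (pi_H theta T (grad h)) Y = Y h.
Proof.
by move=> hY; rewrite /pi_H (metricBl riem) (metricZl riem) gTh// mulr0 subr0 hgrad.
Qed.

Variables (f : Cinf M) (u : VF M).
Hypothesis Tf : T f = 0 :> Cinf M.
Hypothesis hu : hz u.
Hypothesis gradH : forall Y, hz Y -> g u Y = Y f.

Lemma hessE X Y : hz Y -> g (nabla X u) Y = X (Y f) - nabla X Y f.
Proof.
move=> hY; rewrite -(gradH hY) metric -(gradH (nabla_hz X hY)).
by rewrite addrK.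
Qed.

(** The antisymmetric part of the Hessian is the torsion applied to f, a multiple of T f = 0. *)
Lemma hess_sym X Y : hz X -> hz Y -> g (nabla X u) Y = g (nabla Y u) X.
Proof.
move=> hX hY; rewrite !hessE//.
have := congr1 (fun V : VF M => V f) (torsion_horizontal hth hT hJ hg hN hX hY).
rewrite /torsion VFZ Tf mulr0 !VFB bracketE => H.
apply: Cinf_eq => p; have := congr1 (fun h : Cinf M => h p) H.
by rewrite !CinfE => h; lra.
Qed.

(** T f = 0 turns T (Y f) into [T,Y] f, so the left side is - (tau Y) f. *)
Lemma nablaT_grad Y : hz Y -> g (nabla T u) Y = - A Y u.
Proof.
move=> hY; rewrite hessE// /ps_torsion (metricC riem).
rewrite gradH; last exact: (tau_horizontal hth hT hg hN).
rewrite (tauE hth hT hg hN) VFB bracketE Tf VF_0 subr0.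
by apply: Cinf_eq => p; rewrite !CinfE; ring.
Qed.

(** By symmetry of the Hessian, nabla_u u is half the horizontal gradient of |u|^2. Commuting
    nabla_V with nabla_u produces the curvature and nabla along [V,u]; the T component of [V,u]
    gives the A term through [nablaT_grad]. *)
Lemma bochner_term V : hz V -> g (nabla V (nabla u u)) V =
  g (curvature nabla V u u) V + u (g (nabla V u) V)
  - 2 * g (nabla V u) (nabla u V) + g (nabla V u) (nabla V u)
  + 2 * (g (J V) u * A V u).
Proof.
move=> hV; have hVu := nabla_hz V hu; have huV := nabla_hz u hV.
rewrite metric.
have -> : nabla V (nabla u u) = curvature nabla V u u + nabla u (nabla V u)
    + nabla (bracket V u) u.
  by rewrite /curvature; apply: VF_eq => h q; rewrite !VFE !CinfE; ring.
rewrite (bracket_torsion nabla) (torsion_horizontal hth hT hJ hg hN)//.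
rewrite !(nablaBl conn) (nablaZl conn) !(metricDl riem, metricNl riem) (metricZl riem).
rewrite (hess_sym hVu hV) (hess_sym huV hV) nablaT_grad//.
by apply: Cinf_eq => q; rewrite !CinfE; ring.
Qed.

Lemma bochner p (e : 'I_n.*2 -> VF M) : (\forall q \near p, orthonormal_at E g q e) ->
  \sum_i g (nabla (e i) (nabla u u)) (e i) p =
  \sum_i g (nabla (e i) u) (nabla (e i) u) p + u (div u) p
  + rho u u p - 2 * A u (J u) p.
Proof.
move=> ne; have one := nbhs_singleton ne; have [he ge] := one.
(* The connection coefficients of the frame along u are skew because the frame is orthonormal near
   p; contracted with the symmetric Hessian they vanish, which is [S0]. *)
have ue i j : g (nabla u (e i)) (e j) p = - g (nabla u (e j)) (e i) p.
  apply/eqP; rewrite -addr_eq0 [g (nabla u (e j)) _](metricC riem) -CinfD -metric; apply/eqP.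
  rewrite (@VF_near _ _ _ _ _ (scst M (i == j)%:R)) ?VF_cst//.
  by apply: filterS ne => q [_ geq]; rewrite geq.
have S0 : \sum_i g (nabla (e i) u) (nabla u (e i)) p = 0.
  have E1 : \sum_i g (nabla (e i) u) (nabla u (e i)) p =
      \sum_i \sum_j g (nabla u (e i)) (e j) p * g (nabla (e i) u) (e j) p.
    apply: eq_bigr => i _; rewrite (metricC riem) (parseval hth hT hg _ one); last exact: nabla_hz.
    by apply: eq_bigr => j _; rewrite [g (e j) _](metricC riem).
  have E2 : \sum_i g (nabla (e i) u) (nabla u (e i)) p =
      - \sum_i g (nabla (e i) u) (nabla u (e i)) p.
    rewrite {1}E1 exchange_big/= E1 -sumrN; apply: eq_bigr => i _.
    rewrite -sumrN; apply: eq_bigr => j _.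
    by rewrite ue (hess_sym (he j) (he i)) mulNr.
  by lra.
(* The trace of the A terms is - A(u,Ju), whose sign is opposite to the one in the curvature
   hypothesis. *)
have SA : \sum_i (g (J (e i)) u * A (e i) u) p = - A u (J u) p.
  rewrite -(ps_torsionJ hth hT hJ hg hN hu hu).
  rewrite (orthonormal_tensorial hth hT hg (a := fun V => A V u) _ _ one (hzJ hu)).
  + rewrite -sumrN; apply: eq_bigr => i _.
    by rewrite CinfM (webster_Jl hth hT hJ hg)// (metricC riem) CinfN mulNr.
  + by move=> *; rewrite /ps_torsion /tau (torsionDr conn) (metricDl riem).
  + by move=> *; rewrite /ps_torsion /tau (torsionZr conn) (metricZl riem).
have Sdiv : \sum_i u (g (nabla (e i) u) (e i)) p = u (div u) p.
  rewrite -Cinf_sum -VF_sum; apply: VF_near.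
  by apply: filterS ne => q oneq; rewrite (div_orthonormal oneq hu) Cinf_sum.
rewrite (ricci_orthonormal hth hg hN ric one hu).
transitivity (\sum_i (g (curvature nabla (e i) u u) (e i) p
    + u (g (nabla (e i) u) (e i)) p - 2 * g (nabla (e i) u) (nabla u (e i)) p
    + g (nabla (e i) u) (nabla (e i) u) p + 2 * (g (J (e i)) u * A (e i) u) p)).
  by apply: eq_bigr => i _; rewrite bochner_term.
by rewrite !big_split/= sumrN -!mulr_sumr Sdiv S0 SA; ring.
Qed.

Lemma sum_sqr_ge (m : nat) (b : 'I_m -> R) : (0 < m)%N ->
  (\sum_i b i) ^+ 2 / m%:R <= \sum_i b i ^+ 2.
Proof.
move=> m0; have m0' : m%:R != 0 :> R by rewrite pnatr_eq0 -lt0n.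
pose s := \sum_i b i; rewrite -/s -subr_ge0.
have -> : \sum_i b i ^+ 2 - s ^+ 2 / m%:R = \sum_i (b i - s / m%:R) ^+ 2.
  rewrite [RHS](eq_bigr (fun i => b i ^+ 2 - 2 * (s / m%:R) * b i + (s / m%:R) ^+ 2));
    last by move=> i _; ring.
  rewrite big_split/= sumrB sumr_const card_ord -mulr_sumr -/s -[_ *+ m]mulr_natr.
  by field.
by apply: sumr_ge0 => i _; exact: sqr_ge0.
Qed.

(** Only diagonal Hessian entries are kept: there are 2n of them, with sum div u. For each, |nabla_e
    u - c e|^2 >= 0 gives |nabla_e u|^2 >= c^2. *)
Lemma hess_norm_ge p (e : 'I_n.*2 -> VF M) : (0 < n)%N -> orthonormal_at E g p e ->
  div u p ^+ 2 / (2 * n%:R) <= \sum_i g (nabla (e i) u) (nabla (e i) u) p.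
Proof.
move=> n0 one; have [he ge] := one.
have frames := CR_frames hth hT.
rewrite (div_orthonormal one hu) (_ : 2 * n%:R = n.*2%:R); last by rewrite -mul2n natrM.
apply: le_trans (sum_sqr_ge _ _) _; first by rewrite double_gt0.
apply: ler_sum => i _; set c := g _ (e i) p.
have eii : g (e i) (e i) p = 1 by rewrite ge eqxx.
have := metric_ge0 riem frames (nabla (e i) u - scst M c *: e i) p.
rewrite !(metricBl riem, metricBr riem, metricZl riem, metricZr riem) (metricC riem (e i)) !CinfE eii -/c => h.
by rewrite expr2; lra.
Qed.

Lemma bochner_max (lam k alpha : R) p : (0 < n)%N ->
  (forall q, div u q = lam * f q) ->
  (forall X, hz X -> forall q, k * levi theta J X X q <= rho X X q + 2 * A X (J X) q) ->
  (forall q, g u u q + alpha * f q ^+ 2 <= g u u p + alpha * f p ^+ 2) ->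
  (lam + k + alpha) * g u u p + (lam ^+ 2 / (2 * n%:R) + alpha * lam) * f p ^+ 2 <= 0.
Proof.
move=> n0 divu curv Pmax.
have frames := CR_frames hth hT.
have [e ne] := orthonormal_exists hth hT hg p.
have one := nbhs_singleton ne; have [he ge] := one.
have divE : div u = scst M lam * f by apply: Cinf_eq.
pose P : Cinf M := g u u + scst M alpha * (f * f).
have maxP X := @VF_max_test _ _ _ frames P p _ X.
have {}maxP X : X P p = 0 /\ X (X P) p <= 0.
  by apply: maxP => q; rewrite /P !CinfE -!expr2; exact: Pmax.
(* Half the horizontal gradient of P. *)
pose w := nabla u u + (scst M alpha * f) *: u.
have wP Y : hz Y -> Y P = 2 * g w Y.
  move=> hY; rewrite /P VF_add metric VF_scst VF_mul /w (metricDl riem) (metricZl riem).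
  rewrite (hess_sym hu hY) (gradH hY) (metricC riem u (nabla _ _)).
  by apply: Cinf_eq => q; rewrite !CinfE; ring.
have wmax i : g (nabla (e i) w) (e i) p <= 0.
  have := (maxP (e i)).2; rewrite wP//.
  (* The frame is not parallel at p, but the correction is a first derivative of P and vanishes at
     the maximum. *)
  have -> : e i (2 * g w (e i)) = 2 * g (nabla (e i) w) (e i) + nabla (e i) (e i) P.
    rewrite wP; last exact: nabla_hz.
    by rewrite -[2]/(1 + 1) !mulrDl !mul1r VF_add metric; ring.
  rewrite CinfD (maxP _).1 addr0 => h.
  by have : 2 * g (nabla (e i) w) (e i) p <= 0 := h; rewrite pmulr_rle0.
have sumw : \sum_i g (nabla (e i) w) (e i) p =
    \sum_i g (nabla (e i) (nabla u u)) (e i) p + alpha * g u u p + alpha * f p * div u p.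
  rewrite (div_orthonormal one hu) (parseval hth hT hg _ one)// !mulr_sumr -!big_split/=.
  apply: eq_bigr => i _; rewrite /w (nablaDr conn) (nablaZr conn) VF_scst.
  by rewrite !(metricDl riem) !(metricZl riem) -(gradH (he i)) (metricC riem (e i)) !CinfE; ring.
have lew : \sum_i g (nabla (e i) w) (e i) p <= 0.
  by apply: sumr_le0 => i _; exact: wmax.
rewrite sumw (bochner ne) divE VF_scst CinfM -(gradH hu) !CinfE in lew.
have hB := hess_norm_ge n0 one; rewrite divu in hB.
have c1 := curv u hu p; have c2 := curv (J u) (hzJ hu) p.
have leviE X : hz X -> levi theta J X X = g X X.
  by move=> hX; rewrite (webster_levi hg).
rewrite !leviE ?(webster_JJ hth hT hJ hg)// in c1 c2; last exact: hzJ.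
rewrite (ps_torsionJ hth hT hJ hg hN hu (hzJ (hzJ hu))) in c2.
have rJ := ricci_J hth hT hJ hg hN ric p hu.
have aE : A u (J (J (J u))) = - A u (J u).
  by rewrite (@JJ _ _ _ _ _ _ _ hth hT hJ _ (hzJ hu)) /ps_torsion (metricNr riem).
rewrite aE CinfN in c2.
(* The Bochner formula involves rho(u,u) - 2 A(u,Ju); the weights (n-1)/n and
   1/n on the curvature bounds at u and at Ju produce exactly this sign. *)
have N1 : 1 <= n%:R :> R by rewrite ler1n.
have cB : k * g u u p <= rho u u p - 2 * A u (J u) p.
  have N0 : 0 < n%:R :> R by exact: lt_le_trans N1.
  rewrite -(ler_pM2l N0).
  have c1' : (n%:R - 1) * (k * g u u p) <= (n%:R - 1) * (rho u u p + 2 * A u (J u) p).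
    by rewrite ler_wpM2l ?subr_ge0.
  by lra.
have hE : lam ^+ 2 / (2 * n%:R) * f p ^+ 2 = (lam * f p) ^+ 2 / (2 * n%:R).
  by rewrite exprMn mulrAC.
by rewrite [(_ + alpha * lam) * _]mulrDl hE; lra.
Qed.

End Bochner.

(** * The eigenvalue estimate *)

(* The weight of f^2 in the function to which the maximum principle is applied. *)
Lemma weight_exists (R : realType) (N lam k : R) : 1 <= N -> lam != 0 -> 0 < k ->
  - lam < 2 * N * k / (2 * N - 1) -> exists alpha : R,
  [/\ 0 < alpha, 0 < lam + k + alpha & 0 < lam ^+ 2 / (2 * N) + alpha * lam].
Proof.
move=> N1 lam0 k0; have N0 : 0 < N by lra.
rewrite ltr_pdivlMr; last by lra.
(* For lambda > 0 both coefficients are already positive with alpha = 1, so the sign of eigenvalues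
   need not be known beforehand. *)
move=> lt; have [neg|pos] := ltP lam 0; last first.
  have lam1 : 0 < lam by rewrite lt_neqAle eq_sym lam0.
  exists 1; split=> //; first by lra.
  by rewrite mul1r ltr_wpDl// divr_ge0 ?sqr_ge0//; lra.
(* c is the upper bound for alpha and D the gap between it and the lower bound - lambda - k. The
   strict inequality makes D positive, and alpha = c - eps with eps < c and eps < D is
   admissible. *)
pose c := - lam / (2 * N); pose D := lam + k + c.
have c0 : 0 < c by rewrite divr_gt0//; lra.
have D0 : 0 < D.
  have -> : D = (lam * (2 * N - 1) + 2 * N * k) / (2 * N).
    by rewrite /D /c; field; rewrite gt_eqF.
  by rewrite divr_gt0//; lra.
pose eps := Num.min c D / 2.
have [e0 ec eD] : [/\ 0 < eps, eps < c & eps < D].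
  have m0 : 0 < Num.min c D by rewrite lt_min c0.
  have mc : Num.min c D <= c by rewrite ge_min lexx.
  have mD : Num.min c D <= D by rewrite ge_min lexx orbT.
  by rewrite /eps; split; lra.
exists (c - eps); split; [by lra|by rewrite /D in eD; lra|].
have -> : lam ^+ 2 / (2 * N) + (c - eps) * lam = - lam * eps.
  by rewrite /c; field; rewrite gt_eqF.
by rewrite mulr_gt0//; lra.
Qed.

Theorem theorem1 (R : realType) (n : nat) (M : omanifold R n.*2.+1)
  (E : CR_structure M n)
  (theta : oneform M) (T : VF M) (J : {linear VF M -> VF M})
  (g : VF M -> VF M -> Cinf M) (nabla : VF M -> VF M -> VF M)
  (rho : VF M -> VF M -> Cinf M)
  (grad : Cinf M -> VF M) (div : VF M -> Cinf M)
  (lambda k : R) :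
  compact [set: M] ->
  is_pseudohermitian E theta ->
  is_characteristic theta T ->
  is_complex_structure E T J ->
  levi_positive E theta J ->
  is_webster_metric E theta J T g ->
  is_tanaka_webster E theta J T g nabla ->
  is_ricci nabla rho ->
  is_gradient g grad ->
  is_divergence g div ->
  let Delta_b := sublaplacian theta T grad div in
  lambda != 0 ->
  operator_eigenvalue Delta_b lambda ->
  0 < k ->
  (forall X, horizontal E X -> forall p : M,
     k * levi theta J X X p <=
     rho X X p + 2 * ps_torsion g nabla T X (J X) p) ->
  (exists f : Cinf M,
     [/\ f != 0, Eigen Delta_b lambda f & T f = 0 :> Cinf M]) ->
  2 * n%:R * k / (2 * n%:R - 1) <= - lambda.
Proof.
move=> cM hth hT hJ _ hg hN ric hgrad hdiv Delta_b lam0 _ k0 curv [f [f0 Ef Tf]].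
pose u := pi_H theta T (grad f).
have hu : horizontal E u by exact: horizontal_pi.
have gu Y : horizontal E Y -> g u Y = Y f by move=> hY; exact: (metric_pi_grad hg hgrad).
have divu q : div u q = lambda * f q.
  by have := congr1 (fun h : Cinf M => h q) Ef.
have [p0 fp0] : exists p, f p != 0.
  apply: contrapT => /forallNP H; move/eqP: f0; apply; apply: Cinf_eq => q.
  by apply/eqP/negPn/negP => /H.
case: n M E theta T J g nabla rho grad div cM hth hT hJ hg hN ric hgrad hdiv
  Delta_b curv f f0 Ef Tf u hu gu divu p0 fp0 => [|n]
  M E theta T J g nabla rho grad div cM hth hT hJ hg hN ric hgrad hdiv
  Delta_b curv f f0 Ef Tf u hu gu divu p0 fp0.
  (* In CR dimension 0 the trace computing div u is empty, so lambda f = 0, contrary to f(p0) <> 0.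
     The general argument divides by 2n. *)
  have [e /nbhs_singleton one] := orthonormal_exists hth hT hg p0.
  have := divu p0; rewrite (div_orthonormal hth hT hJ hg hN hdiv one hu) big_ord0.
  by move=> /esym/eqP; rewrite mulf_eq0 (negPf lam0) (negPf fp0).
have frames := CR_frames hth hT.
have riem : is_riemannian g by case: hg.
rewrite leNgt; apply/negP => lt.
have [|alpha [a0 c1 c2]] := weight_exists _ lam0 k0 lt; first by rewrite ler1n.
pose P : Cinf M := g u u + scst M alpha * (f * f).
have PE q : P q = g u u q + alpha * f q ^+ 2 by rewrite /P !CinfE expr2.
have [||p _ Pmax] := @compact_EVT_max M R P [set: M] _ cM.
- by exists p0.
- exact/continuous_subspaceT/Cinf_continuous.
have := bochner_max hth hT hJ hg hN ric hdiv Tf hu gu (ltn0Sn n) divu curv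
  (k := k) (alpha := alpha) (p := p).
have Pmax' q : g u u q + alpha * f q ^+ 2 <= g u u p + alpha * f p ^+ 2.
  by rewrite -!PE; apply: Pmax; exact/mem_set.
move=> /(_ Pmax') le0.
have gp := metric_ge0 riem frames u p; have gp0 := metric_ge0 riem frames u p0.
have G1 : 0 <= (lambda + k + alpha) * g u u p by rewrite mulr_ge0 ?(ltW c1).
have F1 : 0 <= (lambda ^+ 2 / (2 * n.+1%:R) + alpha * lambda) * f p ^+ 2.
  by rewrite mulr_ge0 ?(ltW c2) ?sqr_ge0.
have : (lambda + k + alpha) * g u u p +
    (lambda ^+ 2 / (2 * n.+1%:R) + alpha * lambda) * f p ^+ 2 == 0.
  by rewrite eq_le le0 addr_ge0.
rewrite paddr_eq0// (mulf_eq0 (lambda + k + alpha)) (mulf_eq0 _ (f p ^+ 2)).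
rewrite (gt_eqF c1) (gt_eqF c2)/= => /andP[/eqP Gp /eqP Fp].
have := Pmax' p0; rewrite Gp Fp mulr0 addr0 leNgt => /negP; apply.
by rewrite ltr_wpDl// mulr_gt0// exprn_even_gt0.
Qed.
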